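(* Let $q$ be a prime power and let $A=(a_{ij})\in \mathbb{F}_q^{m\times k}$ be a row-balanced matrix of rank $m$. If $A$ is tame, then the balanced system $Ax^\mathsf{T}=0$ (i.e. $a_{i1}x_1+\cdots+a_{ik}x_k=0$ for $i\in[m]$, with $x_1,\ldots,x_k\in\mathbb{F}_q^n$) is temperate.
   Context: $A$ is row-balanced if $\sum_{j\in[k]}a_{ij}=0$ for all $i\in[m]$. A solution $x=(x_1,\ldots,x_k)$ with $x_j\in\mathbb{F}_q^n$ is generic if the set of vectors $(\mu_1,\ldots,\mu_k)\in\mathbb{F}_q^k$ with $\mu_1x_1+\cdots+\mu_kx_k=0$ and $\mu_1+\cdots+\mu_k=0$ equals the row space of $A$. A set $S\subseteq\mathbb{F}_q^n$ contains a solution $x$ if $x_1,\ldots,x_k\in S$. The system is temperate if there is a $\delta>0$ such that $|S|=O(q^{(1-\delta)n})$ (as $n\to\infty$) for every $S\subseteq\mathbb{F}_q^n$ containing no generic solution. A matrix $A\in\mathbb{F}^{m\times k}$ of rank $m$ is tame if, by elementary row operations and column permutations, it cannot be brought into the form $\left(\begin{smallmatrix}A'&0\\ B&C\end{smallmatrix}\right)$ with $A'\in\mathbb{F}^{m'\times k'}$ and $k'\leq 2m'$. *)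

(* Defs.v *)
From HB Require Import structures.
From mathcomp Require Import all_boot all_order all_algebra perm.
From mathcomp Require Import classical_sets filter reals topology exp.

Set Implicit Arguments.
Unset Strict Implicit.
Unset Printing Implicit Defensive.

Import Order.TTheory GRing.Theory Num.Theory.

Local Open Scope ring_scope.

Section Matrices.

Variables (F : finFieldType) (m k : nat).
Implicit Types (A B : 'M[F]_(m, k)) (i r : 'I_m).

Definition row_balanced A : Prop := forall i, \sum_(j < k) A i j = 0.

Definition scale_row i (c : F) A : 'M[F]_(m, k) :=
  \matrix_(r, j) if r == i then c * A r j else A r j.

Definition add_row i i' (c : F) A : 'M[F]_(m, k) :=
  \matrix_(r, j) if r == i then A r j + c * A i' j else A r j.

Inductive brought_into A : 'M[F]_(m, k) -> Prop :=
| brought_refl : brought_into A A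
| brought_xrow i i' B :
    brought_into A B -> brought_into A (xrow i i' B)
| brought_scale_row i c B :
    c != 0 -> brought_into A B -> brought_into A (scale_row i c B)
| brought_add_row i i' c B :
    i != i' -> brought_into A B -> brought_into A (add_row i i' c B)
| brought_col_perm (s : 'S_k) B :
    brought_into A B -> brought_into A (col_perm s B).

(* For m' = 0 the inequality k' <= 2 * m' forces A' to be the empty 0 x 0
   block, and every matrix has the required form; hence 0 < m'. The other
   blocks may have zero rows or columns: m' = m and k' = k are allowed, so a
   tame matrix with 0 < m has k > 2 * m. *)
Definition tame A : Prop :=
  ~ exists (m' m'' k' k'' : nat) (em : (m' + m'')%N = m)
      (ek : (k' + k'')%N = k) (A' : 'M[F]_(m', k')) (B : 'M[F]_(m'', k'))
      (C : 'M[F]_(m'', k'')),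
      [/\ (0 < m')%N, (k' <= 2 * m')%N &
          brought_into A (castmx (em, ek) (block_mx A' 0 B C))].

Definition solution A (n : nat) (x : 'I_k -> 'rV[F]_n) : Prop :=
  forall i, \sum_(j < k) A i j *: x j = 0.

Definition generic A (n : nat) (x : 'I_k -> 'rV[F]_n) : Prop :=
  forall mu : 'rV[F]_k,
    (\sum_(j < k) mu 0 j *: x j = 0 /\ \sum_(j < k) mu 0 j = 0)
    <-> (mu <= A)%MS.

Definition contains_generic_solution A (n : nat) (S : {set 'rV[F]_n}) : Prop :=
  exists x : 'I_k -> 'rV[F]_n,
    [/\ solution A x, generic A x & forall j, x j \in S].

(* The implied constant c depends on A (hence on F) but not on n or S. *)
Definition temperate (R : realType) A : Prop :=
  exists2 delta : R, 0 < delta &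
  exists c : R, \forall n \near \oo%classic, forall S : {set 'rV[F]_n},
    ~ contains_generic_solution A S ->
    #|S|%:R <= c * #|F|%:R `^ ((1 - delta) * n%:R).

End Matrices.

(* Main.v *)
(* Write q = #|F|, X for the k x n matrix with rows x_1, ..., x_k, and let N_r be
   the number of solutions in S whose rows span an affine space of dimension
   r - 1. Generic solutions are those with r = k - m, and N_1 >= |S|. The
   theorem follows by iterating: if r < k - m and N_r is nearly q^(r n), then
   N_r' is nearly q^(r' n) for some r' > r.

   Suppose not, and let W be the space of relations shared by a positive
   proportion of the solutions counted by N_r, so that A < W. Intersect S with
   the fibres over u_1, ..., u_k of a random surjection h onto F^l, where
   W u = 0 and d = n - l is a small fraction of n. On average the fibres keep
   a proportion q^(- eta d) of all solutions of W in dimension d, whereas the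
   solutions of A that do not solve W disappear. On the resulting product of
   subsets of F^d, the equations A and W thus have the same solutions.

   The indicator of A Y = 0 is a polynomial of degree m (q - 1) d. By matroid
   union, tameness yields two bases C1, C2 of the columns of W whose union has
   more than 2 m elements. Fix the rows of Y outside C1 :|: C2; a solution of W
   is then determined by its rows in C2 :\: C1, and also by those in
   C1 :\: C2. Every monomial has low degree (a factor 1 - 1/k below average) in
   the rows of C2 :\: C1, or of C1 :\: C2, or in a single row of C1 :&: C2.
   Contracting the rows in C1 :&: C2 with weights that are orthogonal to
   monomials of low degree turns the indicator into a diagonal matrix of low
   rank, which bounds the number of solutions. *)
Require Import Defs.
From HB Require Import structures.
From mathcomp Require Import all_boot all_order all_algebra perm.
From mathcomp Require Import classical_sets filter reals topology exp.
From mathcomp Require Import finfield sequences zify ring lra.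

Set Implicit Arguments.
Unset Strict Implicit.
Unset Printing Implicit Defensive.

Import Order.TTheory GRing.Theory Num.Theory.

(** * Matroid union *)

Section RankFunctions.
Import boot.fintype boot.finset.
Local Open Scope nat_scope.
Variable T : finType.
Implicit Types (X Y Z C E I : {set T}) (x j : T) (r : {set T} -> nat).

(** These are the axioms of a matroid rank function. In this abstract form the inductions below can
    pass to contractions, and the results apply to column ranks. *)
Definition rank_fun r : Prop :=
  [/\ r set0 = 0,
      forall x X, r (x |: X) <= (r X).+1,
      forall X Y, X \subset Y -> r X <= r Y &
      forall X Y, r (X :|: Y) + r (X :&: Y) <= r X + r Y].

Lemma rank_fun_leDcard r X Y : rank_fun r -> r (X :|: Y) <= r X + #|Y|.
Proof.
move=> rf; have [n] := ubnP #|Y|; elim: n Y => // n IH Y.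
have [->|[y yY]] := set_0Vmem Y; first by rewrite setU0 leq_addr.
case: (rf) => _ r1 _ _; rewrite (cardsD1 y) yY => Yn.
rewrite -(setD1K yY) setUCA (leq_trans (r1 _ _)) // setD1K //.
by have := IH (Y :\ y)%SET; lia.
Qed.

Lemma rank_fun_le_card r X : rank_fun r -> r X <= #|X|.
Proof.
by move=> rf; case: (rf) => r0 _ _ _; have := rank_fun_leDcard set0 X rf;
   rewrite set0U r0.
Qed.

(** Add the elements of [E] one at a time: [C :|: (E :\ y)] and [y |: C] both have the rank of [C]
    and both contain [C], so by submodularity their union has this rank too. *)
Lemma rank_fun_closure r C E : rank_fun r ->
  (forall x, x \in E -> r (x |: C) <= r C) -> r (C :|: E) = r C.
Proof.
move=> rf; case: (rf) => _ _ rm rs; have [n] := ubnP #|E|.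
elim: n E => // n IH E; have [->|[y yE]] := set_0Vmem E; first by rewrite setU0.
rewrite (cardsD1 y) yE => En CE.
have {IH} IH : r (C :|: (E :\ y)) = r C.
  by apply: IH => [|x]; [lia | rewrite in_setD1 => /andP[_ /CE]].
have := rs (C :|: (E :\ y)) (y |: C); rewrite IH.
have -> : (C :|: (E :\ y)) :|: (y |: C) = C :|: E.
  by rewrite -[in RHS](setD1K yE);
     apply/setP => x; rewrite !inE; case: (x == y); case: (x \in C); case: (x \in E).
have := rm _ _ (subsetUl C E); have := CE _ yE.
suff: r C <= r ((C :|: E :\ y) :&: (y |: C)) by lia.
by apply: rm; rewrite subsetI subsetUl subsetUr.
Qed.

Definition rank_indep r C : bool := r C == #|C|.

Lemma rank_indep_extend r I : rank_fun r -> rank_indep r I ->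
  exists C, [/\ I \subset C, rank_indep r C & r C = r [set: T]].
Proof.
move=> rf rI; have [C /maxsetP[rC Cmax] IC] := maxset_exists (P := rank_indep r) rI.
exists C; split=> //; rewrite -(@rank_fun_closure r C [set: T] rf) ?setUT//.
move=> x _; have [xC|xC] := boolP (x \in C).
  by rewrite (setUidPr _) // sub1set.
rewrite leqNgt; apply/negP => rx.
have rx1 : rank_indep r (x |: C).
  rewrite /rank_indep eqn_leq rank_fun_le_card// cardsU1 xC -(eqP rC).
  exact: rx.
by have /setP/(_ x) := Cmax _ rx1 (subsetUr _ _); rewrite !inE eqxx (negPf xC).
Qed.

Lemma rank_fun_contract r R : rank_fun r -> rank_fun (fun X => r (R :|: X) - r R).
Proof.
move=> rf; case: (rf) => r0 r1 rm rs; split=> [|x X|X Y XY|X Y] /=.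
- by rewrite setU0 subnn.
- by have := r1 x (R :|: X); rewrite setUCA; lia.
- by have := rm _ _ (setUS R XY); lia.
- have := rs (R :|: X) (R :|: Y); rewrite -setUIr -setUUr.
  have := rm _ _ (subsetUl R X); have := rm _ _ (subsetUl R Y).
  have := rm _ _ (subsetUl R (X :&: Y)); have := rm _ _ (subsetUl R (X :|: Y)).
  lia.
Qed.

(* Halmos-Vaughan style induction: split along a tight set if there is one,
   otherwise there is enough slack to give any element to either side. *)
Lemma disjoint_bases E r1 r2 : rank_fun r1 -> rank_fun r2 ->
  (forall X, X \subset E -> r1 E + r2 E <= #|E :\: X| + r1 X + r2 X) ->
  exists C1 C2, [/\ C1 \subset E, C2 \subset E, [disjoint C1 & C2],
    rank_indep r1 C1 /\ r1 C1 = r1 E & rank_indep r2 C2 /\ r2 C2 = r2 E].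
Proof.
have [n] := ubnP #|E|; elim: n E r1 r2 => // n IH E r1 r2 En rf1 rf2 cond.
have [/existsP[X /and4P[XE X0 XnE /eqP tight]]|] :=
    boolP [exists X : {set T}, [&& X \subset E, X != set0, X != E &
       r1 E + r2 E == #|E :\: X| + r1 X + r2 X]].
  have XltE : #|X| < #|E| by apply: proper_card; rewrite properEneq XnE.
  have EXcard : #|E :\: X| + #|X| = #|E|.
    by rewrite cardsD (setIidPr XE); have := subset_leq_card XE; lia.
  have X_gt0 : 0 < #|X| by rewrite card_gt0.
  have [||C1 [C2 [C1X C2X dC [/eqP i1 s1] [/eqP i2 s2]]]] := IH X r1 r2 _ rf1 rf2.
  - by lia.
  - move=> Y YX; have := cond _ (subset_trans YX XE).
    have : #|E :\: Y| = #|E :\: X| + #|X :\: Y|.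
      rewrite !cardsD (setIidPr XE) (setIidPr YX) (setIidPr (subset_trans YX XE)).
      by have := subset_leq_card XE; have := subset_leq_card YX; lia.
    lia.
  have [||D1 [D2 [D1E D2E dD [/eqP j1 t1] [/eqP j2 t2]]]] :=
      IH (E :\: X) _ _ _ (rank_fun_contract X rf1) (rank_fun_contract X rf2).
  - by lia.
  - move=> Z ZE; have XUE : X :|: (E :\: X) = E.
      by rewrite setDE setUIr setUCr setIT; apply/setUidPr.
    rewrite XUE; have := cond (X :|: Z).
    rewrite subUset XE (subset_trans ZE (subsetDl _ _)) => /(_ isT).
    rewrite setDDl.
    case: (rf1) (rf2) => _ _ m1 _ [_ _ m2 _].
    have := m1 _ _ (subsetUl X Z); have := m2 _ _ (subsetUl X Z).
    have := m1 _ _ XE; have := m2 _ _ XE.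
    lia.
  (* A base of the restriction to [X] and a base of the contraction by [X] join to a base of [E]. *)
  have glue r (C D : {set T}) : rank_fun r -> C \subset X -> D \subset E :\: X -> r C = #|C| -> r C = r X ->
      r (X :|: D) - r X = #|D| -> r (X :|: D) - r X = r (X :|: (E :\: X)) - r X ->
      rank_indep r (C :|: D) /\ r (C :|: D) = r E.
    move=> rf CX DE iC sC iD sD.
    have XUE : X :|: (E :\: X) = E.
      by rewrite setDE setUIr setUCr setIT; apply/setUidPr.
    rewrite XUE in sD; case: (rf) => _ _ m s.
    have {}sD : r (X :|: D) = r E.
      by move: (m _ _ XE) (m _ _ (subsetUl X D)) sD; clear; lia.
    have {}iD : r X + #|D| = r E.
      by move: (m _ _ (subsetUl X D)) iD; rewrite sD; clear; lia.
    have CD : [disjoint C & D].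
      rewrite disjoints_subset; apply: subset_trans CX _.
      rewrite -disjoints_subset disjoint_sym disjoints_subset.
      by apply: subset_trans DE _; rewrite setDE subsetIr.
    have cCD : #|C :|: D| = #|C| + #|D| by apply/eqP; rewrite (leq_card_setU C D).
    have := s (C :|: D) X.
    have -> : C :|: D :|: X = X :|: D by rewrite setUAC (setUidPr CX).
    rewrite sD.
    have : r C <= r ((C :|: D) :&: X) by apply: m; rewrite subsetI subsetUl.
    have := rank_fun_le_card (C :|: D) rf.
    have : r (C :|: D) <= r E.
      apply: m; rewrite subUset (subset_trans CX XE).
      by rewrite (subset_trans DE (subsetDl _ _)).
    move: iC sC iD cCD; rewrite /rank_indep; clear => *.
    by split; [apply/eqP|]; lia.
  exists (C1 :|: D1), (C2 :|: D2); split.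
  - by rewrite subUset (subset_trans C1X XE) (subset_trans D1E) ?subsetDl.
  - by rewrite subUset (subset_trans C2X XE) (subset_trans D2E) ?subsetDl.
  - have cross (C D : {set T}) : C \subset X -> D \subset E :\: X -> [disjoint C & D].
      move=> CX DE; rewrite disjoints_subset; apply: subset_trans CX _.
      rewrite -disjoints_subset disjoint_sym disjoints_subset.
      by apply: subset_trans DE _; rewrite setDE subsetIr.
    rewrite -setI_eq0 setIUl !setIUr !setU_eq0 !setI_eq0.
    by rewrite dC dD (cross C1)//= disjoint_sym (cross C2).
  - exact: glue.
  - exact: glue.
rewrite negb_exists => /forallP slack0.
have slack X : X \subset E -> X != set0 -> X != E ->
    r1 E + r2 E < #|E :\: X| + r1 X + r2 X.
  move=> XE X0 XnE; have := slack0 X; rewrite XE X0 XnE /= => neq.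
  by rewrite ltn_neqAle neq cond.
clear slack0; case: (rf1) (rf2) => r10 r11 m1 s1 [r20 r21 m2 s2].
(* Without a proper nonempty tight set, any [j] that is not a loop of [ra] can go to the first base:
   contract it in [ra] and delete it from [E]. The strict inequality absorbs the unit lost in the
   condition, and applied to [E :\ j] it shows that [rb] keeps its full rank there. *)
have step ra rb j : rank_fun ra -> rank_fun rb ->
    (forall X, X \subset E -> ra E + rb E <= #|E :\: X| + ra X + rb X) ->
    (forall X, X \subset E -> X != set0 -> X != E ->
      ra E + rb E < #|E :\: X| + ra X + rb X) ->
    j \in E -> ra [set j] != 0 ->
    exists C1 C2, [/\ C1 \subset E, C2 \subset E, [disjoint C1 & C2],
      rank_indep ra C1 /\ ra C1 = ra E & rank_indep rb C2 /\ rb C2 = rb E].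
  move=> rfa rfb condab slackab jE ra_j.
  case: (rfa) (rfb) => ra0 ra1 ma sa [rb0 rb1 mb sb].
  have ra_j1 : ra [set j] = 1.
    by have := rank_fun_le_card [set j] rfa; rewrite cards1; case: (ra _) ra_j => [|[]].
  have jEsub : [set j] \subset E by rewrite sub1set.
  have Ecard : #|E| = (#|E :\ j|).+1 by rewrite (cardsD1 j) jE.
  have EJ : j |: (E :\ j) = E by rewrite setD1K.
  have [||D1 [D2 [D1E D2E dD [/eqP j1 t1] [/eqP j2 t2]]]] :=
      IH (E :\ j) _ _ _ (rank_fun_contract [set j] rfa) rfb.
  - by lia.
  - move=> Z ZE; rewrite EJ ra_j1.
    have ZE' : Z \subset E by rewrite (subset_trans ZE) ?subsetDl.
    have jZ : j \notin Z.
      by apply/negP => /(subsetP ZE); rewrite !inE eqxx.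
    have cEZ : #|E :\: Z| = (#|(E :\ j) :\: Z|).+1.
      by rewrite (cardsD1 j) inE jE jZ /= setDDl setUC -setDDl.
    have := mb _ _ (subsetDl E [set j]).
    have : 1 <= ra (j |: Z) by rewrite -ra_j1; apply: ma; rewrite subsetUl.
    have [Z0|Z0] := eqVneq Z set0.
      subst Z; rewrite setU0 ra_j1 rb0; have := ma _ _ jEsub.
      by have := condab _ (sub0set _); rewrite ra0 rb0; lia.
    have ZnE : Z != E by apply: contraNneq jZ => ->.
    have := slackab _ ZE' Z0 ZnE; have := ma _ _ (subsetUr [set j] Z).
    by have := ma _ _ jEsub; rewrite ra_j1; lia.
  have jD1 : j \notin D1 by apply/negP => /(subsetP D1E); rewrite !inE eqxx.
  have jD2 : j \notin D2 by apply/negP => /(subsetP D2E); rewrite !inE eqxx.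
  have rbE : rb (E :\ j) = rb E.
    apply/eqP; rewrite eqn_leq mb ?subsetDl//=.
    have [E0|E0] := eqVneq (E :\ j) set0.
      have := condab _ (sub0set _); rewrite setD0 ra0 rb0 Ecard E0 cards0.
      by have := ma _ _ jEsub; rewrite ra_j1; lia.
    have EJn : E :\ j != E by apply/eqP => /setP /(_ j); rewrite !inE eqxx jE.
    have := slackab _ (subsetDl _ _) E0 EJn.
    have -> : #|E :\: (E :\ j)| = 1.
      by rewrite setDDr setDv set0U (setIidPr jEsub) cards1.
    by move: (ma _ _ (subsetDl E [set j])); clear; lia.
  have ge1 X : 1 <= ra (j |: X) by rewrite -ra_j1; apply: ma; rewrite subsetUl.
  exists (j |: D1), D2; rewrite -rbE; split.
  - by rewrite subUset jEsub (subset_trans D1E) ?subsetDl.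
  - by rewrite (subset_trans D2E) ?subsetDl.
  - rewrite -setI_eq0 setIUl setU_eq0 !setI_eq0 dD andbT disjoints_subset.
    by rewrite sub1set inE jD2.
  - rewrite EJ in t1; rewrite /rank_indep cardsU1 jD1.
    by move: (ge1 D1) (ge1 (E :\ j)) ra_j1 t1 j1; rewrite EJ; clear; split; lia.
  - by split=> //; apply/eqP.
have [/existsP[j /andP[jE rj]]|no1] := boolP [exists j, (j \in E) && (r1 [set j] != 0)].
  exact: (step r1 r2 j).
have [/existsP[j /andP[jE rj]]|no2] := boolP [exists j, (j \in E) && (r2 [set j] != 0)].
  have [||C1 [C2 [C1E C2E dC p1 p2]]] := step r2 r1 j rf2 rf1 _ _ jE rj.
  - by move=> X XE; have := cond X XE; lia.
  - by move=> X XE X0 XnE; have := slack X XE X0 XnE; lia.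
  - by exists C2, C1; rewrite disjoint_sym.
have zero r : rank_fun r -> ~~ [exists j, (j \in E) && (r [set j] != 0)] -> r E = 0.
  move=> rf; rewrite negb_exists => /forallP no; case: (rf) => r0 _ _ _.
  rewrite -(set0U E) (rank_fun_closure rf) ?r0// => x xE.
  by have := no x; rewrite xE negbK setU0 => /eqP ->.
exists set0, set0; rewrite !sub0set /rank_indep cards0 r10 r20.
by rewrite (zero r1)// (zero r2)// -setI_eq0 setI0; split.
Qed.

(* Two bases of largest possible union: an element of both bases that is lost
   could be traded for a new one. *)
Lemma maximal_base_pair r s I1 I2 : rank_fun r ->
  (forall j, r [set~ j] = r [set: T]) ->
  rank_indep r I1 -> rank_indep r I2 -> s <= #|I1 :|: I2| ->
  exists C1 C2, [/\ rank_indep r C1 /\ r C1 = r [set: T],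
    rank_indep r C2 /\ r C2 = r [set: T], s <= #|C1 :|: C2| &
    forall j, j \in C1 :&: C2 -> r ((C1 :|: C2) :\ j) = r [set: T]].
Proof.
move=> rf nocoloop i1 i2 sI.
pose base C := rank_indep r C && (r C == r [set: T]).
pose P := [pred p : {set T} * {set T} | base p.1 && base p.2].
have [C1 [IC1 iC1 sC1]] := rank_indep_extend rf i1.
have [C2 [IC2 iC2 sC2]] := rank_indep_extend rf i2.
have P0 : P (C1, C2) by rewrite /P /base /= iC1 iC2 sC1 sC2 eqxx.
pose f (p : {set T} * {set T}) := #|p.1 :|: p.2|.
case: (arg_maxnP f P0) => -[D1 D2] /= /andP[/andP[iD1 /eqP sD1] /andP[iD2 /eqP sD2]] Dmax.
exists D1, D2; split=> //.
  apply: leq_trans sI _; apply: leq_trans (Dmax _ P0).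
  by apply: subset_leq_card; rewrite setUSS.
case: (rf) => r0 r1 m sm.
move=> j /setIP[jD1 jD2]; apply/eqP; rewrite eqn_leq m ?subsetT//= leqNgt.
apply/negP => lt.
have rD1j : (r (D1 :\ j)).+1 = r [set: T].
  have := r1 j (D1 :\ j); rewrite setD1K// sD1 => le1.
  apply/eqP; rewrite eqn_leq le1 andbT; apply: leq_trans lt; rewrite ltnS.
  by apply: m; rewrite setSD ?subsetUl.
have [/existsP[f' /andP[fD rf']]|] :=
    boolP [exists x, (x \notin D1 :|: D2) && (r (D1 :\ j) < r (x |: (D1 :\ j)))].
  have fD1 : f' \notin D1 :\ j.
    by apply: contra fD => /setD1P[_ ?]; rewrite inE ?orbT//; apply/orP; left.
  have PD : P (f' |: (D1 :\ j), D2).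
    rewrite /P /base /= iD2 sD2 eqxx !andbT; have := r1 f' (D1 :\ j).
    have := cardsD1 j D1; rewrite jD1; move/eqP: iD1.
    rewrite /rank_indep cardsU1 fD1; move: rf' rD1j sD1; clear => *.
    by apply/andP; split; apply/eqP; lia.
  have := Dmax _ PD; rewrite /f /= leqNgt => /negP; apply.
  apply: proper_card; apply/properP; split.
    apply/subsetP => x; rewrite !inE; have [->|] //= := eqVneq x j.
    - by rewrite jD2 !orbT.
    - by move=> _ /orP[]->; rewrite ?orbT.
  by exists f' => //; rewrite !inE eqxx.
(* No exchange is possible, so [D1 :\ j] spans everything except [j]: elements outside the union by
   [no], the others because by [lt] the union without [j] has rank at most that of [D1 :\ j]. Then
   [[set~ j]] is not of full rank, against [nocoloop]. *)
rewrite negb_exists => /forallP no.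
have: r ((D1 :\ j) :|: [set~ j]) = r (D1 :\ j).
  apply: rank_fun_closure => // x xj.
  have [xU|xU] := boolP (x \in D1 :|: D2); last first.
    by have := no x; rewrite xU /= -leqNgt.
  rewrite -ltnS rD1j; apply: leq_trans lt; apply: m.
  rewrite subUset setSD ?subsetUl// andbT sub1set inE xU andbT.
  by move: xj; rewrite !inE.
rewrite (setUidPr _) ?nocoloop; first by rewrite -rD1j => /eqP; rewrite -[_ == _]negbK neq_ltn ltnSn orbT.
by apply/subsetP => x; rewrite !inE => /andP[].
Qed.

End RankFunctions.

(** * Tame systems and the column matroid *)

Section ColumnMatroid.
Import boot.fintype boot.finset.
Local Open Scope ring_scope.
Variables (F : fieldType) (k : nat).
Implicit Types (X Y : {set 'I_k}).

(** Columns are selected by zeroing the others with this diagonal projection. All matrices keep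
    width [k], and no dimension depends on [X]. *)
Definition colmask X : 'M[F]_k := diag_mx (\row_j (j \in X)%:R).

Lemma mulmx_colmaskE s (B : 'M[F]_(s, k)) X i j : (B *m colmask X) i j = B i j * (j \in X)%:R.
Proof. by rewrite mul_mx_diag !mxE. Qed.

Lemma colmask_mulmxE s (B : 'M[F]_(k, s)) X i j : (colmask X *m B) i j = (i \in X)%:R * B i j.
Proof. by rewrite mul_diag_mx !mxE. Qed.

Lemma colmask_mul X Y : colmask X *m colmask Y = colmask (X :&: Y).
Proof.
apply/matrixP => i j; rewrite mulmx_colmaskE !mxE inE.
have [<-|] := eqVneq i j; last by rewrite !mulr0n mul0r.
by rewrite -natrM mulnb mulr1n.
Qed.

Lemma colmask_tr X : (colmask X)^T = colmask X.
Proof. by rewrite tr_diag_mx. Qed.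

Lemma colmaskT : colmask [set: 'I_k] = 1%:M.
Proof. by apply/matrixP => i j; rewrite !mxE in_setT mulr1n. Qed.

Lemma colmask0 : colmask set0 = 0.
Proof.
apply/matrixP => i j; rewrite !mxE in_set0 mulr0n.
by rewrite mul0rn.
Qed.

Lemma colmask_setC X : colmask X + colmask (~: X) = 1%:M.
Proof.
apply/matrixP => i j; rewrite !mxE -mulrnDl in_setC.
by case: (i \in X); rewrite /= ?mulr0n ?addr0 ?add0r.
Qed.

Definition colrank s (B : 'M[F]_(s, k)) X := \rank (B *m colmask X).

Lemma colrankE s (B : 'M[F]_(s, k)) X : colrank B X = \rank (colmask X *m B^T).
Proof. by rewrite /colrank -mxrank_tr trmx_mul colmask_tr. Qed.

Lemma colmask_subr s (B : 'M[F]_(k, s)) X Y : X \subset Y -> (colmask X *m B <= colmask Y *m B)%MS.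
Proof. by move=> XY; rewrite -(setIidPl XY) -colmask_mul -mulmxA submxMl. Qed.

(** Submodularity is the dimension formula for the row spaces of [colmask X *m B^T]: their sum
    contains the space for the union, their intersection the space for the intersection. *)
Lemma colrank_rank_fun s (B : 'M[F]_(s, k)) : rank_fun (colrank B).
Proof.
split=> [|x X|X Y XY|X Y].
- by rewrite /colrank colmask0 mulmx0 mxrank0.
- rewrite !colrankE -[(\rank _).+1]addn1.
  apply: leq_trans (leq_add (leqnn _) (rank_leq_row (row x B^T))).
  apply: leq_trans (mxrank_adds_leqif _ _).
  apply: mxrankS; apply/row_subP => i.
  have [->|ix] := eqVneq i x.
    apply: submx_trans (addsmxSr _ _); suff -> : row x (colmask (x |: X) *m B^T) = row x B^T by [].
    by apply/rowP => j; rewrite !mxE big_mkcond (bigD1 x)//= big1 ?addr0 => [|i' /negPf i'x];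
      rewrite !mxE ?inE ?eqxx ?mul1r // eq_sym i'x mulr0n mul0r.
  apply: submx_trans (addsmxSl _ _).
  suff -> : row i (colmask (x |: X) *m B^T) = row i (colmask X *m B^T) by apply: row_sub.
  by apply/rowP => j; rewrite !(mxE, colmask_mulmxE) !inE (negPf ix).
- by rewrite !colrankE mxrankS // colmask_subr.
- rewrite !colrankE -[leqRHS]mxrank_sum_cap; apply: leq_add; apply: mxrankS.
    have -> : colmask (X :|: Y) = colmask X + colmask (Y :\: X).
      apply/matrixP => i j; rewrite !mxE -mulrnDl !inE.
      by case: (i \in X); case: (i \in Y); rewrite /= ?mulr0n ?addr0 ?add0r.
    rewrite mulmxDl; apply: addmx_sub_adds => //; apply: colmask_subr.
    exact: subsetDl.
  by rewrite sub_capmx !colmask_subr // ?subsetIl ?subsetIr.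
Qed.

Lemma rank_colmask X : \rank (colmask X) = #|X|.
Proof.
have rf := colrank_rank_fun (1%:M : 'M[F]_k).
have le Z : (\rank (colmask Z) <= #|Z|)%N.
  by have := rank_fun_le_card Z rf; rewrite /colrank mul1mx.
have : (k <= \rank (colmask X) + \rank (colmask (~: X)))%N.
  rewrite -{1}(mxrank1 F k) -(colmask_setC X); apply: leq_trans (mxrank_adds_leqif _ _).
  by apply/mxrankS/addmx_sub_adds.
have := le X; have := le (~: X); have := cardsC X; rewrite card_ord.
by move: #|X| #|~: X| (\rank _) (\rank _); lia.
Qed.

End ColumnMatroid.

(** * Block forms, and what tameness says about column ranks *)

Section Tame.
Import boot.fintype boot.finset.
Local Open Scope ring_scope.
Variables (F : finFieldType) (m k : nat).
Implicit Types (A B : 'M[F]_(m, k)) (X : {set 'I_k}).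

Lemma brought_add_rows A B (i : 'I_m) (c : 'I_m -> F) (s : seq 'I_m) :
  brought_into A B -> i \notin s ->
  brought_into A (\matrix_(r, j) if r == i then B i j + \sum_(i' <- s) c i' * B i' j
                                 else B r j).
Proof.
move=> AB; elim: s => [_|i' s IH].
  rewrite (_ : (\matrix_(r, j) _) = B) //; apply/matrixP => r j; rewrite !mxE.
  by have [->|//] := eqVneq r i; rewrite big_nil addr0.
rewrite inE negb_or => /andP[ii' /IH {}IH].
have := brought_add_row (c i') ii' IH; congr brought_into.
apply/matrixP => r j; rewrite !mxE; have [_|//] := eqVneq r i.
by rewrite eq_sym (negPf ii') big_cons addrAC addrA.
Qed.

(** Gaussian elimination, one row per step. Row combinations that vanish on the columns in [X] form
    a space of dimension at least [m - colrank A X > z], and those supported on the rows from [z] on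
    have dimension at least [m - z]; so some nonzero [c] is of both kinds. It replaces a row [i0]
    with [c 0 i0 != 0], which is then swapped into position [z]. *)
Lemma brought_zero_rows A X z : (z <= m - colrank A X)%N ->
  exists B, [/\ brought_into A B, (B <= A)%MS &
    forall (i : 'I_m) j, (i < z)%N -> j \in X -> B i j = 0].
Proof.
elim: z => [_|z IH zr]; first by exists A; split=> //; exact: brought_refl.
have [B [AB BA B0]] := IH (ltnW zr).
have rB : (colrank B X <= colrank A X)%N by rewrite mxrankS // submxMr.
pose Z := [set i : 'I_m | (z <= i)%N].
have zm : (z < m)%N by lia.
have cZ : (#|Z| >= m - z)%N.
  have : (#|~: Z| <= z)%N.
    rewrite -[leqRHS]card_ord; apply: leq_trans (leq_imset_card (widen_ord (ltnW zm)) _).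
    apply/subset_leq_card/subsetP => i; rewrite !inE -ltnNge => iz.
    by apply/imsetP; exists (Ordinal iz) => //; apply: val_inj.
  by have := cardsC Z; rewrite card_ord; lia.
have : (0 < \rank (kermx (B *m colmask F X) :&: colmask F Z)%MS)%N.
  have := mxrank_sum_cap (kermx (B *m colmask F X)) (colmask F Z).
  rewrite rank_colmask mxrank_ker -/(colrank _ _).
  have := rank_leq_col (kermx (B *m colmask F X) + colmask F Z)%MS.
  move: (\rank (_ + _)%MS) (\rank (_ :&: _)%MS) => a b; move: zr rB cZ zm.
  by move: #|Z| (colrank A X) (colrank B X); clear; lia.
rewrite lt0n mxrank_eq0 => /rowV0Pn[c]; rewrite sub_capmx => /andP[/sub_kermxP cB cZ'] c0.
have cz (i : 'I_m) : (i < z)%N -> c 0 i = 0.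
  case/submxP: cZ' => u -> iz; rewrite mulmx_colmaskE inE leqNgt iz.
  by rewrite mulr0.
have [i0 ci0] : exists i, c 0 i != 0 by apply/rV0Pn.
have zi0 : (z <= i0)%N by rewrite leqNgt; apply: contra ci0 => /cz ->.
have i0s : i0 \notin [seq i <- enum 'I_m | i != i0] by rewrite mem_filter eqxx.
have AB1 := brought_add_rows (c 0) (brought_scale_row i0 ci0 AB) i0s.
set B1 := (X in brought_into _ X) in AB1.
have B1i0 j : B1 i0 j = (c *m B) 0 j.
  rewrite !mxE eqxx [RHS](bigD1 i0)//=; congr (_ + _).
  rewrite big_filter big_enum_cond /=; apply: eq_bigr => i ii0.
  by rewrite !mxE (negPf ii0).
have B1i i j : i != i0 -> B1 i j = B i j by move=> /negPf ii0; rewrite !mxE ii0.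
exists (xrow (Ordinal zm) i0 B1); split.
- exact: brought_xrow.
- rewrite xrowE; apply: submx_trans (submxMl _ _) _; apply: submx_trans BA.
  apply/row_subP => i; have [->|ii0] := eqVneq i i0.
    suff -> : row i0 B1 = c *m B by apply: submxMl.
    by apply/rowP => j; rewrite -B1i0 mxE.
  suff -> : row i B1 = row i B by apply: row_sub.
  by apply/rowP => j; rewrite mxE B1i // mxE.
- move=> i j iz jX.
  have B1i00 : B1 i0 j = 0.
    rewrite B1i0; move/matrixP/(_ 0 j): cB; rewrite mulmxA mulmx_colmaskE jX mulr1.
    by move=> ->; rewrite mxE.
  rewrite mxE; case: tpermP => [_ //|ii0|/eqP ni1 /eqP ni2].
    suff -> : Ordinal zm = i0 by [].
    by apply/val_inj/eqP; rewrite eqn_leq zi0 /= -ii0.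
  rewrite B1i // B0 // ltn_neqAle -ltnS iz andbT.
  by apply: contra ni1 => /eqP iz'; apply/eqP/val_inj.
Qed.

Lemma exists_perm_initial (Y : {set 'I_k}) : exists s : 'S_k, forall j, (s j \in Y) = (j < #|Y|)%N.
Proof.
pose l := enum Y ++ enum (~: Y).
have lsize : size l == k by rewrite size_cat -!cardE cardsC card_ord.
have : perm_eq (Tuple lsize) (ord_tuple k).
  apply: uniq_perm; rewrite ?val_ord_tuple ?enum_uniq //.
    rewrite /= cat_uniq !enum_uniq andbT /=; apply/hasPn => x.
    by rewrite !mem_enum inE.
  by move=> x; rewrite mem_cat !mem_enum inE orbN.
case/tuple_permP => s ls; exists s => j.
have -> : s j = nth j l j.
  by rewrite [l]ls -tnth_nth tnth_mktuple tnth_ord_tuple.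
rewrite nth_cat -cardE; case: ltnP => jY; first by rewrite -mem_enum mem_nth // -cardE.
apply/negbTE; have: nth j (enum (~: Y)) (j - #|Y|) \in enum (~: Y).
  by rewrite mem_nth // -cardE; have := cardsC Y; have := ltn_ord j; rewrite card_ord; lia.
by rewrite mem_enum inE.
Qed.

(** Otherwise, clearing the columns in [X] from [m - colrank A X] rows and moving the columns in
    [~: X] to the front gives the forbidden form with [m' = m - colrank A X] and [k' = #|~: X|]. *)
Lemma tame_colrank A X : tame A -> (colrank A X < m)%N -> (2 * (m - colrank A X) < #|~: X|)%N.
Proof.
move=> tA rm; rewrite ltnNge; apply/negP => small; apply: tA.
have [B [AB _ B0]] := @brought_zero_rows A X _ (leqnn _).
have [s sP] := exists_perm_initial (~: X).
have em : ((m - colrank A X) + colrank A X = m)%N by rewrite subnK // ltnW.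
have ek : (#|~: X| + (k - #|~: X|) = k)%N.
  by rewrite subnKC //; have := max_card [in ~: X]; rewrite card_ord.
pose M := castmx (esym em, esym ek) (col_perm s B).
exists (m - colrank A X)%N, (colrank A X), #|~: X|, (k - #|~: X|)%N, em, ek,
  (ulsubmx M), (dlsubmx M), (drsubmx M); split=> //; first by rewrite subn_gt0.
suff M0 : ursubmx M = 0 by rewrite -M0 submxK castmx_comp castmx_id; exact: brought_col_perm.
apply/matrixP => i j; rewrite !mxE castmxE !mxE; apply: B0; first exact: (ltn_ord i).
by rewrite -[_ \in X]negbK -in_setC sP /= -leqNgt leq_addr.
Qed.

End Tame.

(** * Two bases of [W] with a large union *)

Section BasePairs.
Import boot.fintype boot.finset.
Local Open Scope ring_scope.
Variables (F : finFieldType) (m k : nat).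

Lemma colrankT s (W : 'M[F]_(s, k)) : colrank W [set: 'I_k] = \rank W.
Proof. by rewrite /colrank colmaskT mulmx1. Qed.

(** Column [j] is minus the sum of the other columns, and multiplication by [N] restores it. In
    matroid terms, [W] has no coloops. *)
Lemma colrank_setC1 s (W : 'M[F]_(s, k)) j :
  W *m const_mx 1 = 0 :> 'cV_s -> colrank W [set~ j] = \rank W.
Proof.
move=> W1; apply/eqP; rewrite eqn_leq mxrankM_maxl /=.
pose N : 'M[F]_k := \matrix_(i, c) ((i == c)%:R - (c == j)%:R).
suff -> : \rank W = \rank (W *m colmask F [set~ j] *m N) by rewrite mxrankM_maxl.
congr (\rank _); apply/matrixP => i c; rewrite mxE.
have Wij : W i j = - \sum_(l | l != j) W i l.
  move/matrixP/(_ i 0): W1; rewrite !mxE (bigD1 j)//= mxE mulr1 => /eqP.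
  rewrite addr_eq0 => /eqP ->; congr (- _); apply: eq_bigr => l _.
  by rewrite mxE mulr1.
under eq_bigr do rewrite mulmx_colmaskE !mxE in_setC1 mulrBr.
rewrite sumrB [X in X - _](bigD1 c)//= eqxx mulr1 [X in _ + X - _]big1 ?addr0; last first.
  by move=> l /negPf lc; rewrite lc mulr0.
have [->|cj] := eqVneq c j; last first.
  by rewrite mulr1 big1 ?subr0 // => l _; rewrite mulr0.
rewrite /= mulr0 sub0r Wij; congr (- _); rewrite big_mkcond /=; apply: eq_bigr => l _.
by rewrite mulr1; case: eqP => _; rewrite ?mulr0 ?mulr1.
Qed.

Lemma colrank_submx s t (V : 'M[F]_(s, k)) (W : 'M[F]_(t, k)) X :
  (V <= W)%MS -> (colrank V X <= colrank W X)%N.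
Proof. by move=> VW; rewrite mxrankS // submxMr. Qed.

(** A row of [W] outside the row space of [A] is appended to [A], giving [P] of rank [m + 1].
    Matroid union for [P] and [A] yields disjoint sets of sizes [m + 1] and [m], both independent
    for [W]; they extend to bases whose union has at least [2 * m + 1] elements. *)
Lemma good_base_pair s (A : 'M[F]_(m, k)) (W : 'M[F]_(s, k)) :
  \rank A = m -> tame A -> (A <= W)%MS -> (m < \rank W)%N ->
  (forall j, colrank W [set~ j] = \rank W) ->
  exists C1 C2, [/\ colrank W C1 = #|C1| /\ #|C1| = \rank W,
    colrank W C2 = #|C2| /\ #|C2| = \rank W, (2 * m < #|C1 :|: C2|)%N &
    forall j, j \in C1 :&: C2 -> colrank W ((C1 :|: C2) :\ j) = \rank W].
Proof.
move=> rA tA AW mW nocoloop.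
have [i Wi] : exists i, ~~ (row i W <= A)%MS.
  by apply/row_subPn; apply: contraTN mW => /mxrankS; rewrite rA -leqNgt.
pose P := col_mx A (row i W).
have PW : (P <= W)%MS by rewrite col_mx_sub AW row_sub.
have rP : \rank P = m.+1.
  apply/eqP; rewrite eqn_leq -{1}[m.+1]addn1 rank_leq_row /= -{1}rA.
  apply: rank_ltmx; rewrite ltmxE /P; apply/andP; split.
    by rewrite -addsmxE addsmxSl.
  by apply: contra Wi; rewrite col_mx_sub => /andP[].
have rfP := colrank_rank_fun P; have rfA := colrank_rank_fun A.
have [X _|C1 [C2 [_ _ dC [iC1 sC1] [iC2 sC2]]]] := disjoint_bases (E := [set: 'I_k]) rfP rfA.
  (* The union condition: tameness gives it if [A] loses rank on [X]; otherwise it reduces to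
     [m + 1 <= colrank P X + #|~: X|]. *)
  have AP : (colrank A X <= colrank P X)%N by apply: colrank_submx; rewrite -addsmxE addsmxSl.
  rewrite !colrankT rP rA.
  have := rank_fun_leDcard X (~: X) rfP; rewrite setUCr colrankT rP.
  have := @tame_colrank _ _ _ A X tA; move: AP; rewrite setTD.
  move: #|~: X| (colrank A X) (colrank P X) => y a p ap; clear -ap.
  by case: (ltnP a m) => [am /(_ isT)|ma _]; lia.
have indepW C s' (V : 'M[F]_(s', k)) : (V <= W)%MS -> rank_indep (colrank V) C ->
    rank_indep (colrank W) C.
  move=> VW /eqP iC; rewrite /rank_indep eqn_leq rank_fun_le_card //=; last exact: colrank_rank_fun.
  by rewrite -iC colrank_submx.
have card12 : (2 * m < #|C1 :|: C2|)%N.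
  have -> : (#|C1 :|: C2| = #|C1| + #|C2|)%N by apply/eqP; rewrite (leq_card_setU C1 C2).
  rewrite -(eqP iC1) -(eqP iC2) sC1 sC2 !colrankT rP rA; lia.
have [j|||D1 [D2 [[/eqP iD1 sD1] [/eqP iD2 sD2] sD jD]]] :=
    maximal_base_pair (colrank_rank_fun W) _ _ _ card12.
- by rewrite colrankT nocoloop.
- exact: indepW PW iC1.
- exact: indepW AW iC2.
- exists D1, D2; rewrite -iD1 -iD2 sD1 sD2 !colrankT; split=> // j jj.
  by rewrite -colrankT jD.
Qed.

End BasePairs.

(** * Counting over a finite field *)

Section LinearCounting.
Import boot.fintype boot.finset.
Local Open Scope ring_scope.
Variable F : finFieldType.
Local Notation q := #|F|.

Lemma card_submx n k (K : 'M[F]_k) :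
  #|[set U : 'M[F]_(n, k) | (U <= K)%MS]| = (q ^ (\rank K * n))%N.
Proof.
rewrite mulnC -card_mx; have injf : injective (fun V : 'M[F]_(n, \rank K) => V *m row_base K).
  by move=> V1 V2 /(row_free_inj (row_base_free K)).
rewrite -(card_imset _ injf); apply: eq_card => U; rewrite inE; apply/idP/imsetP => [|[V _ ->]].
  by rewrite -(eq_row_base K) => /submxP[V ->]; exists V.
by rewrite (submx_trans (submxMl _ _)) // eq_row_base.
Qed.

Lemma card_kernel s k n (Z : 'M[F]_(s, k)) :
  #|[set Y : 'M[F]_(k, n) | Z *m Y == 0]| = (q ^ ((k - \rank Z) * n))%N.
Proof.
rewrite -(mxrank_tr Z) -mxrank_ker -card_submx -(card_imset _ trmx_inj).
apply: eq_card => U; rewrite inE; apply/imsetP/sub_kermxP => [[Y]|UZ].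
  by rewrite inE => /eqP ZY ->; rewrite -trmx_mul ZY trmx0.
by exists U^T; rewrite ?trmxK // inE -[Z *m _]trmxK trmx_mul trmxK UZ trmx0.
Qed.

Lemma card_kernel_le s k n (Z : 'M[F]_(s, k)) r : (k <= r + \rank Z)%N ->
  (#|[set Y : 'M[F]_(k, n) | Z *m Y == 0%R]| <= q ^ (r * n))%N.
Proof.
move=> kr; rewrite card_kernel leq_exp2l ?card_finNzRing_gt1 //.
by rewrite leq_mul2r leq_subLR addnC kr orbT.
Qed.

(** Union bound: a matrix [h] of rank below [l] kills one of fewer than [q ^ l] nonzero columns [v],
    each [v] is killed by a proportion of at most [q ^ - n], and [2 * q ^ l <= q ^ n]. *)
Lemma card_surjective n l : (l < n)%N ->
  (q ^ (n * l) <= 2 * #|[set h : 'M[F]_(n, l) | \rank h == l]|)%N.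
Proof.
move=> ln; have q1 : (1 < q)%N by exact: card_finNzRing_gt1.
pose N := [set h : 'M[F]_(n, l) | \rank h != l].
suff : (2 * #|N| <= q ^ (n * l))%N.
  have eqC : ~: N = [set h | \rank h == l] by apply/setP => h; rewrite !inE negbK.
  have := cardsC N; rewrite card_mx eqC.
  by move: #|N| #|[set h | \rank h == l]| (q ^ _)%N; clear; lia.
pose B (v : 'cV[F]_l) := [set h : 'M[F]_(n, l) | h *m v == 0].
have NB : N \subset \bigcup_(v | v != 0) B v.
  apply/subsetP => h; rewrite inE => rh.
  have : kermx h^T != 0.
    rewrite -mxrank_eq0 mxrank_ker mxrank_tr subn_eq0 -ltnNge ltn_neqAle rh.
    exact: rank_leq_col.
  case/rowV0Pn => v /sub_kermxP vh v0; apply/bigcupP; exists v^T.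
    by rewrite trmx_eq0.
  by rewrite inE -[h]trmxK -trmx_mul vh trmx0.
have cB v : v != 0 -> (#|B v| * q ^ n <= q ^ (n * l))%N.
  move=> v0; rewrite -(card_imset _ trmx_inj).
  have rv : \rank v^T = 1%N by apply/eqP; rewrite eqn_leq rank_leq_row lt0n mxrank_eq0 trmx_eq0.
  have l0 : (0 < l)%N by case: (l) v v0 rv => // v v0; rewrite thinmx0 mxrank0.
  apply: (@leq_trans (q ^ ((l - 1) * n) * q ^ n)).
    rewrite leq_mul2r; apply/orP; right.
    apply: leq_trans (card_kernel_le n (Z := v^T) (r := l - 1) _).
      apply: subset_leq_card; apply/subsetP => Y /imsetP[h]; rewrite !inE => /eqP hv ->.
      by rewrite -trmx_mul hv trmx0.
    by rewrite rv subnK.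
  by rewrite -expnD leq_exp2l // -mulSnr -subSn // subSS subn0 mulnC.
have {}NB : (#|N| * q ^ n <= q ^ l * q ^ (n * l))%N.
  have c1 : (q ^ l = #|{: 'cV[F]_l}|)%N by rewrite card_mx muln1.
  rewrite c1 -[#|{: 'cV[F]_l}|]sum1_card; apply: leq_trans (leq_mul (subset_leq_card NB) (leqnn _)) _.
  have : (#|\bigcup_(v | v != 0%R) B v| <= \sum_(v | v != 0%R) #|B v|)%N.
    elim/big_rec2: _ => [|v c U _ Uc]; first by rewrite cards0.
    by apply: leq_trans (leq_card_setU _ _) _; rewrite leq_add2l.
  move=> /leq_mul/(_ (leqnn (q ^ n)))/leq_trans; apply; rewrite !big_distrl /=.
  rewrite big_mkcond /=; apply: leq_sum => v _; rewrite mul1n.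
  by case: ifP => [/cB|] //.
have q2 : (2 * q ^ l <= q ^ n)%N.
  apply: (@leq_trans (q ^ l.+1)); last by rewrite leq_exp2l.
  by rewrite expnS leq_mul2r q1 orbT.
have := leq_trans (leq_mul (leqnn #|N|) q2) NB.
by rewrite mulnA [leqRHS]mulnC leq_pmul2r ?expn_gt0 ?(ltnW q1) // mulnC.
Qed.

End LinearCounting.

(** * Monomials of low degree *)

Section LowDegree.
Import boot.fintype boot.finset.
Local Open Scope ring_scope.

(* Exponents supported on [D], of total degree at most [1 - 1/k] times the mean
   degree [q.-1 / 2 * #|D|]. *)
Definition low_exponents (I : finType) q k (D : {set I}) : {set {ffun I -> 'I_q}} :=
  [set f : {ffun I -> 'I_q} | [forall i, (i \notin D) ==> (f i == 0%N :> nat)] &&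
    (2 * k * (\sum_(i in D) f i) <= k.-1 * q.-1 * #|D|)%N].

Variable R : realType.

(** Compare with [(1 - y)^-1], the inverse of a lower bound for [expR (- y)]. *)
Lemma expR_le_quadratic (y : R) : `|y| <= 2^-1 -> expR y <= 1 + y + 2 * y ^+ 2.
Proof.
move=> y2; have [y_ge y_le] : - 2^-1 <= y /\ y <= 2^-1 by apply/andP; rewrite -ler_norml.
have y1 : 0 < 1 - y by lra.
rewrite -[y in expR y]opprK expRN; apply: (@le_trans _ _ (1 - y)^-1).
  by rewrite lef_pV2 ?posrE ?expR_gt0 // expR_ge1Dx.
rewrite -[leLHS]mul1r ler_pdivrMr //.
have : 0 <= y ^+ 2 * (1 - 2 * y) by rewrite mulr_ge0 ?sqr_ge0 //; lra.
rewrite -[1 <= _]subr_ge0 => H; suff <- : y ^+ 2 * (1 - 2 * y) = (1 + y + 2 * y ^+ 2) * (1 - y) - 1 by []; ring.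
Qed.

(** The threshold lies [(q - 1) / (2 * k)] below the mean [(q - 1) / 2] of the exponents, so the
    linear term of the exponential is negative on average. *)
Lemma sum_expR_lt (q k : nat) : (1 < q)%N -> (0 < k)%N -> exists t s : R, [/\ 0 < t, 0 < s &
  \sum_(a < q) expR (t * (k.-1%:R * q.-1%:R / (2 * k%:R) - a%:R)) <= q%:R * (1 - s)].
Proof.
move=> q1 k0; have q1R : 2 <= q%:R :> R by rewrite ler_nat.
have k1R : 1 <= k%:R :> R by rewrite ler1n.
have qp : q.-1%:R = q%:R - 1 :> R by rewrite -subn1 natrB // ltnW.
have kp : k.-1%:R = k%:R - 1 :> R by rewrite -subn1 natrB.
set th := _ / _.
have th_eq : th = (q%:R - 1) / 2 - (q%:R - 1) / (2 * k%:R).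
  by rewrite /th qp kp; field; apply/eqP => k00; move: k1R; rewrite k00; lra.
have th0 : 0 <= th by rewrite /th divr_ge0 // mulr_ge0.
have d0 : 0 <= (q%:R - 1) / (2 * k%:R) :> R by apply: divr_ge0; lra.
(* This makes the quadratic error [2 * t ^+ 2 * q ^+ 2] equal to [t / (4 * k)], half of the least
   possible linear gain [t / (2 * k)], which occurs at [q = 2]. *)
pose t : R := (8 * k%:R * q%:R ^+ 2)^-1.
have den : 0 < 8 * k%:R * q%:R ^+ 2 :> R.
  by rewrite !mulr_gt0 ?exprn_gt0 ?ltr0n // ltnW.
have t0 : 0 < t by rewrite invr_gt0.
have tq : t * (8 * k%:R * q%:R ^+ 2) = 1 by rewrite mulVf // gt_eqF.
clearbody t; exists t, (t / (4 * k%:R)); split=> //; first by rewrite divr_gt0 // mulr_gt0 // ltr0n.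
have bnd (a : 'I_q) : expR (t * (th - a%:R)) <=
    1 + t * (th - a%:R) + 2 * t ^+ 2 * q%:R ^+ 2.
  have aq : a%:R <= q%:R :> R by rewrite ler_nat ltnW.
  have a0 : 0 <= a%:R :> R by [].
  have tha : `|th - a%:R| <= q%:R by rewrite ler_norml; apply/andP; split; lra.
  have sq : (th - a%:R) ^+ 2 <= q%:R ^+ 2.
    by rewrite -[(th - _) ^+ 2]real_normK ?num_real // lerXn2r ?nnegrE.
  apply: le_trans (expR_le_quadratic _) _.
    rewrite normrM (gtr0_norm t0); apply: (@le_trans _ _ (t * q%:R)); first by rewrite ler_pM2l.
    have kq : 0 < 8 * k%:R * q%:R :> R by rewrite !mulr_gt0 ?ltr0n // ltnW.
    rewrite -(ler_pM2r kq) (_ : _ * q%:R * _ = 1); last by rewrite -[RHS]tq; ring.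
    rewrite -ler_pdivrMl ?invr_gt0 // invrK mulr1 -[2]mulr1.
    by have : 1 <= k%:R * q%:R :> R; [apply: mulr_ege1; lra | lra].
  rewrite lerD2l exprMn -mulrA ler_pM2l ?mulr_gt0 // ler_pM2l // exprn_gt0 //.
apply: (@le_trans _ _ (\sum_(a < q) (1 + t * (th - a%:R) + 2 * t ^+ 2 * q%:R ^+ 2))).
  exact: ler_sum.
have suma n : \sum_(a < n) a%:R = n%:R * (n%:R - 1) / 2 :> R.
  by elim: n => [|n IH]; rewrite ?big_ord0 ?mul0r // big_ord_recr /= IH -natr1; field.
rewrite !big_split /= !sumr_const card_ord -mulr_sumr sumrB suma sumr_const card_ord.
rewrite -[th *+ q]mulr_natr -[_ * _ *+ q]mulr_natr th_eq.
have k_neq0 : k%:R != 0 :> R by rewrite pnatr_eq0 -lt0n.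
have tq2 : t * q%:R ^+ 2 = k%:R^-1 / 8.
  have k8 : 8 * k%:R != 0 :> R by rewrite mulf_neq0 // pnatr_eq0.
  apply: (mulIf k8); transitivity (1 : R); last by field.
  by rewrite -[RHS]tq; ring.
rewrite -subr_ge0 [X in 0 <= X](_ : _ = t * q%:R * k%:R^-1 * (q%:R - 2) / 2); last first.
  rewrite -[2 * t ^+ 2 * _]mulrA [t ^+ 2 * _](_ : _ = t * (t * q%:R ^+ 2)); last by ring.
  by rewrite tq2; field.
by rewrite divr_ge0 // mulr_ge0 ?subr_ge0 // !mulr_ge0 ?invr_ge0 // ltW.
Qed.

(* Chernoff bound: each exponent in [D] is weighted by [expR (t * (th - a))]. *)
Lemma card_low_exponents (q k : nat) : (1 < q)%N -> (0 < k)%N -> exists2 e, (0 < e)%N &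
  forall (I : finType) (D : {set I}),
    (#|low_exponents q k D| * q ^ (#|D| %/ e) <= q ^ #|D|)%N.
Proof.
move=> q1 k0; have [t [s [t0 s0 ts]]] := sum_expR_lt q1 k0.
set th := _ / _ in ts.
(* A saving of [expR (- s)] per coordinate amounts to a factor [q] for every [e] coordinates, since
   [q <= expR (s * e)]. *)
pose e := (Num.bound (q%:R / s)).+1.
have qe : q%:R <= expR (s * e%:R).
  apply: le_trans (expR_ge1Dx _); apply: ler_wpDl => //.
  rewrite mulrC -ler_pdivrMr //; apply/ltW/(lt_le_trans (archi_boundP _)); first by rewrite divr_ge0 // ltW.
  by rewrite ler_nat.
exists e => // I D; rewrite -(ler_nat R) natrM !natrX.
pose w i (a : 'I_q) : R := if i \in D then expR (t * (th - a%:R)) else (a == 0%N :> nat)%:R.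
have cardw : #|low_exponents q k D|%:R <= \prod_i \sum_a w i a.
  rewrite bigA_distr_bigA /= -sum1_card natr_sum big_mkcond /=; apply: ler_sum => f _.
  have w0 i a : 0 <= w i a by rewrite /w; case: ifP => // _; exact: expR_ge0.
  case: ifP => [|_]; last by apply: prodr_ge0.
  rewrite inE => /andP[/forallP f0 flow].
  rewrite (bigID (mem D)) /= [X in _ * X]big1 ?mulr1; last first.
    by move=> i iD; rewrite /w (negPf iD) (implyP (f0 i) iD).
  under eq_bigr => i iD do rewrite /w iD.
  rewrite -expR_sum; apply: le_trans (expR_ge1Dx _); rewrite lerDl -mulr_sumr.
  rewrite mulr_ge0 ?(ltW t0) // sumrB sumr_const subr_ge0.
  rewrite -natr_sum -(mulr_natr th) /th mulrAC ler_pdivlMr ?mulr_gt0 ?ltr0n //.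
  by rewrite -!natrM ler_nat mulnC.
have q0 : 0 < q%:R :> R by rewrite ltr0n ltnW.
have prodw : \prod_i \sum_a w i a <= (q%:R * expR (- s)) ^+ #|D|.
  rewrite -prodr_const [leRHS]big_mkcond /=; apply: ler_prod => i _; rewrite /w.
  case: ifP => iD; apply/andP; split.
  - by apply: sumr_ge0 => a _; exact: expR_ge0.
  - by apply: (le_trans ts); rewrite ler_pM2l // expR_ge1Dx.
  - by apply: sumr_ge0.
  - case: (q) q1 => // q' _; rewrite big_ord_recl /= big1 ?addr0 // => a _.
apply: (le_trans (ler_wpM2r _ (le_trans cardw prodw))); first by rewrite exprn_ge0 // ltW.
rewrite exprMn -mulrA ler_piMr ?exprn_ge0 ?(ltW q0) //.
rewrite expRN exprVn mulrC ler_pdivrMr ?exprn_gt0 ?expR_gt0 // mul1r.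
apply: (@le_trans _ _ (expR (s * e%:R) ^+ (#|D| %/ e))).
  by rewrite lerXn2r ?nnegrE ?(ltW q0) ?expR_ge0.
rewrite -!expRM_natl ler_expR mulrCA [leRHS]mulrC ler_pM2l // -natrM ler_nat.
exact: leq_trunc_div.
Qed.

End LowDegree.

(** * Polynomial functions and orthogonal weights *)

Section PolynomialFunctions.
Import boot.fintype boot.finset.
Local Open Scope ring_scope.
Variables (F : finFieldType) (I : finType).
Local Notation q := #|F|.
Local Notation exps := {ffun I -> 'I_q}.

Definition monomial (e : exps) (y : I -> F) : F := \prod_i y i ^+ e i.

(** Only values matter, so exponents are kept below [q]; [D] bounds the total degree of this reduced
    form. *)
Definition poly_fun D (f : (I -> F) -> F) : Prop :=
  exists2 c : exps -> F, (forall e, c e != 0 -> (\sum_i e i <= D)%N) &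
    forall y, f y = \sum_e c e * monomial e y.

Lemma poly_fun_ext D f g : f =1 g -> poly_fun D f -> poly_fun D g.
Proof. by move=> fg [c cD fE]; exists c => // y; rewrite -fg fE. Qed.

Lemma poly_fun_le D D' f : (D <= D')%N -> poly_fun D f -> poly_fun D' f.
Proof. by move=> DD' [c cD fE]; exists c => // e /cD /leq_trans; apply. Qed.

Lemma poly_fun_const D a : poly_fun D (fun=> a).
Proof.
have q0 : (0 < q)%N by apply/card_gt0P; exists 0.
pose e0 : exps := [ffun=> Ordinal q0].
exists (fun e => a *+ (e == e0)) => [e|y].
  have [-> _|_] := eqVneq e e0; last by rewrite eqxx.
  by rewrite big1 // => i _; rewrite ffunE.
rewrite (bigD1 e0)//= eqxx mulr1n /monomial big1 ?mulr1 => [|i _]; last by rewrite ffunE.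
by rewrite big1 ?addr0 // => e /negPf ->; rewrite mulr0n mul0r.
Qed.

Lemma poly_fun_lin D f g a : poly_fun D f -> poly_fun D g ->
  poly_fun D (fun y => f y + a * g y).
Proof.
move=> [c cD fE] [c' cD' gE]; exists (fun e => c e + a * c' e) => [e|y].
  have [c0|] := eqVneq (c e) 0; last by move=> /cD.
  have [c'0|] := eqVneq (c' e) 0; last by move=> /cD'.
  by rewrite c0 c'0 mulr0 addr0 eqxx.
by rewrite fE gE mulr_sumr -big_split; apply: eq_bigr => e _; rewrite mulrDl mulrA.
Qed.

Lemma poly_fun_mulX D f i : poly_fun D f -> poly_fun D.+1 (fun y => y i * f y).
Proof.
have q1 : (1 < q)%N by exact: card_finNzRing_gt1.
move=> [c cD fE].
(* [x ^ q = x] on [F], so an exponent that reaches [q] is lowered to [1]. *)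
pose next (a : 'I_q) : 'I_q :=
  if (a.+1 < q)%N =P true is ReflectT lt then Ordinal lt else Ordinal q1.
have nextX (a : 'I_q) (x : F) : x ^+ next a = x * x ^+ a.
  rewrite /next; case: eqP => /= [_|/negP]; first by rewrite exprS.
  rewrite -leqNgt => qa; rewrite -exprS expr1.
  by have -> : a.+1 = q; [apply/eqP; rewrite eqn_leq ltn_ord | rewrite expf_card].
have next_le (a : 'I_q) : (next a <= a.+1)%N by rewrite /next; case: eqP.
pose sh (e : exps) : exps := [ffun i' => if i' == i then next (e i') else e i'].
exists (fun e' => \sum_(e | sh e == e') c e) => [e' /eqP sum0|y].
  have [e] : exists e, (sh e == e') && (c e != 0).
    apply/existsP; rewrite -[X in is_true X]negbK negb_exists; apply/negP => /forallP no.
    by apply: sum0; rewrite big1 // => e ee; have := no e; rewrite ee /= negbK => /eqP.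
  case/andP => /eqP <- /cD; rewrite -ltnS; apply: leq_trans.
  rewrite (bigD1 i)//= [X in (_ <= X.+1)%N](bigD1 i)//= ffunE eqxx -addSn.
  apply: leq_add => //; apply: leq_sum => i' /negPf i'i.
  by rewrite ffunE i'i.
rewrite fE mulr_sumr.
under [RHS]eq_bigr do rewrite mulr_suml.
rewrite (exchange_big_dep predT)//=; apply: eq_bigr => e _.
rewrite (big_pred1 (sh e)) => [|e']; last by rewrite eq_sym.
rewrite mulrCA; congr (_ * _).
rewrite /monomial (bigD1 i)//= [RHS](bigD1 i)//= ffunE eqxx nextX mulrA; congr (_ * _).
by apply: eq_bigr => i' /negPf i'i; rewrite ffunE i'i.
Qed.

Lemma poly_fun_mul_linear D f (a : I -> F) : poly_fun D f ->
  poly_fun D.+1 (fun y => (\sum_i a i * y i) * f y).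
Proof.
move=> fD.
suff: forall s : seq I, poly_fun D.+1 (fun y => (\sum_(i <- s) a i * y i) * f y) by apply.
elim=> [|i s IH].
  by apply: poly_fun_ext (poly_fun_const _ 0) => y; rewrite big_nil mul0r.
apply: poly_fun_ext (poly_fun_lin (a i) IH (poly_fun_mulX i fD)) => y.
by rewrite big_cons mulrDl -mulrA addrC.
Qed.

(** For a linear form [l], the indicator of [l = 0] is [1 - l ^+ q.-1] by Fermat. *)
Lemma poly_fun_mul_indicator D f (a : I -> F) : poly_fun D f ->
  poly_fun (D + q.-1) (fun y => (\sum_i a i * y i == 0)%:R * f y).
Proof.
move=> fD.
have pow n : poly_fun (D + n) (fun y => (\sum_i a i * y i) ^+ n * f y).
  elim: n => [|n IH]; first by rewrite addn0; apply: poly_fun_ext fD => y; rewrite expr0 mul1r.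
  by rewrite addnS; apply: poly_fun_ext (poly_fun_mul_linear a IH) => y; rewrite exprS mulrA.
have q1 : (1 < q)%N by exact: card_finNzRing_gt1.
apply: poly_fun_ext (poly_fun_lin (- 1) (poly_fun_le (leq_addr _ _) fD) (pow q.-1)) => y.
have [->|l0] := eqVneq (\sum_i a i * y i) 0.
  by rewrite expr0n -subn1 subn_eq0 leqNgt q1 mul0r mulr0 addr0 mul1r.
suff -> : (\sum_i a i * y i) ^+ q.-1 = 1 by rewrite !mul1r mulN1r subrr mulr0n mul0r.
by apply: (mulfI l0); rewrite -exprS prednK ?(ltnW q1) // expf_card mulr1.
Qed.

Lemma poly_fun_indicator (J : finType) (a : J -> I -> F) :
  poly_fun (#|J| * q.-1) (fun y => [forall j, \sum_i a j i * y i == 0]%:R).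
Proof.
suff: forall s : seq J, poly_fun (size s * q.-1)
    (fun y => (all (fun j => \sum_i a j i * y i == 0) s)%:R).
  move/(_ (enum J)); rewrite -cardE; apply: poly_fun_ext => y; congr (nat_of_bool _)%:R.
  apply/allP/forallP => H j; first by apply: H; rewrite mem_enum.
  by move=> _; apply: H.
elim=> [|j s IH]; first exact: poly_fun_const.
rewrite /= mulSnr; apply: poly_fun_ext (poly_fun_mul_indicator (a j) IH) => y.
by rewrite -natrM mulnb.
Qed.

End PolynomialFunctions.

(** * Orthogonal weights with few zeros, and the rank of diagonal matrices *)

Section Weights.
Import boot.fintype boot.finset.
Local Open Scope ring_scope.
Variable F : finFieldType.

(** The left kernel of [B] has dimension at least [n - p]. On as many suitable coordinates it
    projects isomorphically, so it contains a vector equal to 1 on all of these. *)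
Lemma orthogonal_row n p (B : 'M[F]_(n, p)) :
  exists2 v : 'rV[F]_n, v *m B = 0 & (#|[set i | v 0%R i == 0%R]| <= p)%N.
Proof.
set K := row_base (kermx B).
have Kfull : row_full K^T by rewrite /row_full mxrank_tr; exact: row_base_free.
pose f := fullrankfun Kfull; pose M := rowsub f K^T.
have Munit : M \in unitmx by exact: fullrowsub_unit.
pose w : 'cV[F]_(\rank (kermx B)) := invmx M *m const_mx 1.
exists (w^T *m K).
  apply/sub_kermxP; rewrite (submx_trans (submxMl _ _)) //.
  by rewrite (eq_row_base (kermx B)).
have fK j : (w^T *m K) 0 (f j) = 1.
  transitivity ((M *m w) j 0).
    rewrite mxE [RHS]mxE; apply: eq_bigr => l _.
    by rewrite [_^T 0 l]mxE [M _ _]mxE [K^T _ _]mxE mulrC.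
  by rewrite mulKVmx // mxE.
set Z := [set i | _].
have finj : injective f by exact: fullrankfun_inj.
have ZC : Z \subset ~: (f @: [set: 'I_(\rank (kermx B))]).
  apply/subsetP => i; rewrite inE => /eqP i0; rewrite inE; apply/imsetP => -[j _ ij].
  by move: i0; rewrite ij fK => /eqP; rewrite oner_eq0.
apply: leq_trans (subset_leq_card ZC) _.
have := cardsC (f @: [set: 'I_(\rank (kermx B))]); rewrite (card_imset _ finj) cardsT !card_ord.
have := rank_leq_col B; have := mxrank_ker B.
by move: #|~: _| => c; move: (\rank (kermx B)) (\rank B); clear; lia.
Qed.

Lemma orthogonal_weights (X L : finType) (phi : L -> X -> F) :
  exists2 h : X -> F, forall l, \sum_x h x * phi l x = 0 & (#|[set x | h x == 0%R]| <= #|L|)%N.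
Proof.
pose B : 'M[F]_(#|X|, #|L|) := \matrix_(i, l) phi (enum_val l) (enum_val i).
have [v vB vz] := orthogonal_row B.
exists (fun x => v 0 (enum_rank x)) => [l|].
  have /matrixP/(_ 0 (enum_rank l)) := vB; rewrite !mxE => vBl; rewrite -[RHS]vBl.
  rewrite (reindex_onto enum_rank enum_val) => [|i _]; last exact: enum_valK.
  by apply: eq_big => [x|x _]; rewrite ?mxE ?enum_rankK ?eqxx.
apply: leq_trans vz; rewrite -(card_imset _ (@enum_rank_inj X)).
apply/subset_leq_card/subsetP => i /imsetP[x]; rewrite !inE => hx ->; exact: hx.
Qed.

(** Vanishing outside [S] is imposed as orthogonality to the indicators of the points of [~: S].
    These extra [#|~: S|] conditions are balanced by the [#|~: S|] zeros outside [S]. *)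
Lemma supported_orthogonal_weights (X L : finType) (D : {set L}) (S : {set X})
    (phi : L -> X -> F) :
  exists h : X -> F, [/\ forall x, x \notin S -> h x = 0,
    forall l, l \in D -> \sum_x h x * phi l x = 0 &
    (#|[set x in S | h x == 0%R]| <= #|D|)%N].
Proof.
pose psi (l : {l | l \in D} + {x | x \in ~: S}) (x : X) : F :=
  match l with inl l => phi (val l) x | inr x' => (x == val x')%:R end.
have [h hpsi hz] := orthogonal_weights psi; exists h.
have hS x : x \notin S -> h x = 0.
  move=> xS; have xS' : x \in ~: S by rewrite inE.
  have := hpsi (inr (exist _ x xS')); rewrite /= (bigD1 x)//= eqxx mulr1 big1 ?addr0 //.
  by move=> y /negPf ->; rewrite mulr0.
split=> // [l lD|]; first by have := hpsi (inl (exist _ l lD)).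
move: hz; rewrite card_sum !card_sig.
have -> : [set x | h x == 0] = [set x in S | h x == 0] :|: ~: S.
  by apply/setP => x; rewrite !inE;
    by case: (boolP (x \in S)) => [_|/hS ->]; rewrite /= ?orbF ?eqxx.
have /eqP -> : #|[set x in S | h x == 0%R] :|: ~: S| ==
    (#|[set x in S | h x == 0%R]| + #|~: S|)%N.
  rewrite (leq_card_setU _ _) -setI_eq0; apply/eqP/setP => x; rewrite !inE.
  by case: (x \in S); rewrite ?andbF.
by rewrite leq_add2r.
Qed.

(** A diagonal matrix without zeros on the diagonal has full rank, and this one factors through
    dimension [#|D1| + #|D2|]. The two sums allow the few functions to depend on [x] in one part and
    on [x'] in the other. *)
Lemma card_le_of_diagonal (X L : finType) (D : {set X}) (D1 D2 : {set L})
    (u1 u2 : X -> L -> F) (v1 v2 : L -> X -> F) :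
  (forall x x', x \in D -> x' \in D ->
    (\sum_(l in D1) u1 x l * v1 l x' + \sum_(l in D2) u2 x l * v2 l x' != 0) = (x == x')) ->
  (#|D| <= #|D1| + #|D2|)%N.
Proof.
move=> diag.
pose U : 'M[F]_(#|D|, #|D1| + #|D2|) :=
  row_mx (\matrix_(i, l) u1 (enum_val i) (enum_val l)) (\matrix_(i, l) u2 (enum_val i) (enum_val l)).
pose V : 'M[F]_(#|D1| + #|D2|, #|D|) :=
  col_mx (\matrix_(l, i) v1 (enum_val l) (enum_val i)) (\matrix_(l, i) v2 (enum_val l) (enum_val i)).
have UVE i i' : ((U *m V) i i' != 0) = (i == i').
  rewrite mul_row_col !mxE -(inj_eq enum_val_inj) -diag ?enum_valP //.
  by congr (_ + _ != 0); rewrite [RHS]big_enum_val; apply: eq_bigr => l _; rewrite !mxE.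
have UVd : U *m V = diag_mx (\row_i (U *m V) i i).
  apply/matrixP => i i'; rewrite [RHS]mxE [X in X *+ _]mxE.
  have [<-|ii'] := eqVneq i i'; first by rewrite mulr1n.
  by rewrite mulr0n; apply/eqP; rewrite -[_ == 0]negbK UVE.
have UVunit : U *m V \in unitmx.
  rewrite UVd unitmxE det_diag unitfE; apply/prodf_neq0 => i _.
  by rewrite mxE UVE.
by have := mulmx_max_rank U V; rewrite mxrank_unit.
Qed.

End Weights.

(** * Boxes in which two systems have the same solutions *)

Section Box.
Import boot.fintype boot.finset.
Local Open Scope ring_scope.
Variables (F : finFieldType) (m k d : nat).
Local Notation q := #|F|.
Local Notation exps := {ffun 'I_k * 'I_d -> 'I_q}.
Implicit Types (e : exps) (G C : {set 'I_k}) (Y : 'M[F]_(k, d)).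

Definition row_monomial e (j : 'I_k) (x : 'rV[F]_d) : F := \prod_c x 0 c ^+ e (j, c).

Lemma row_indicator_poly (A : 'M[F]_(m, k)) : exists2 c : exps -> F,
  (forall e, c e != 0 -> (\sum_i e i <= m * d * q.-1)%N) &
  forall Y, (A *m Y == 0)%:R = \sum_e c e * \prod_j row_monomial e j (row j Y).
Proof.
pose a (r : 'I_m * 'I_d) (i : 'I_k * 'I_d) : F := A r.1 i.1 * (i.2 == r.2)%:R.
have [c cD cE] := poly_fun_indicator a; exists c => [e /cD|Y].
  by rewrite card_prod !card_ord.
transitivity (\sum_e c e * monomial e (fun i => Y i.1 i.2)).
  rewrite -cE; congr (nat_of_bool _)%:R.
  have aE r : \sum_i a r i * Y i.1 i.2 = (A *m Y) r.1 r.2.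
    rewrite mxE -(pair_bigA _ (fun i1 i2 => a r (i1, i2) * Y i1 i2)) /=.
    apply: eq_bigr => j _; rewrite (bigD1 r.2)//= /a /= eqxx mulr1 big1 ?addr0 //.
    by move=> c' /negPf ->; rewrite mulr0 mul0r.
  apply/eqP/forallP => [AY r|AY]; first by rewrite aE AY mxE.
  by apply/matrixP => r c'; rewrite [RHS]mxE; have := aE (r, c') => /= <-; apply/eqP/AY.
apply: eq_bigr => e _; congr (_ * _); rewrite /monomial.
rewrite (eq_bigr (fun i => Y i.1 i.2 ^+ e (i.1, i.2))) => [|[j c'] _] //.
rewrite -(pair_bigA _ (fun j c' => Y j c' ^+ e (j, c'))) /=.
by apply: eq_bigr => j _; apply: eq_bigr => c' _; rewrite mxE.
Qed.

Definition leg G : {set 'I_k * 'I_d} := setX G [set: 'I_d].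

(** The default exponent is the ordinal 0: [ltnW] turns [1 < q] into [0 < q]. *)
Definition restrict G e : exps := [ffun i => if i \in leg G then e i else
  Ordinal (ltnW (@card_finNzRing_gt1 F))].

Definition low G : {set exps} := low_exponents q k (leg G).

Lemma card_leg G : #|leg G| = (#|G| * d)%N.
Proof. by rewrite cardsX cardsT card_ord. Qed.

Lemma row_monomial_restrict G e j x : j \in G ->
  row_monomial (restrict G e) j x = row_monomial e j x.
Proof. by move=> jG; apply: eq_bigr => c _; rewrite ffunE !inE jG. Qed.

Lemma mem_low G e : (restrict G e \in low G) =
  (2 * k * (\sum_(i in leg G) e i) <= k.-1 * q.-1 * (#|G| * d))%N.
Proof.
rewrite inE card_leg [X in X && _](_ : _ = true) /=; last first.
  by apply/forallP => i; apply/implyP => iG; rewrite ffunE (negPf iG).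
by congr (_ * _ <= _)%N; apply: eq_bigr => i iG; rewrite ffunE iG.
Qed.

(** Otherwise the degree on [C1 :|: C2] would exceed [(k - 1) * (q - 1) * d / (2 * k)] times its
    size [n]. Since [2 * m + 1 <= n <= k], one has [(k - 1) * n >= 2 * k * m], which contradicts the
    bound on the total degree. *)
Lemma low_leg C1 C2 e : (2 * m < #|C1 :|: C2|)%N ->
  (\sum_i e i <= m * d * q.-1)%N ->
  restrict (C2 :\: C1) e \notin low (C2 :\: C1) ->
  restrict (C1 :\: C2) e \notin low (C1 :\: C2) ->
  exists2 j, j \in C1 :&: C2 & restrict [set j] e \in low [set j].
Proof.
move=> m12 deg; rewrite !mem_low -!ltnNge => l1 l2.
apply/exists_inP; rewrite -[X in is_true X]negbK negb_exists_in; apply/negP => /forall_inP l3.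
pose r j := (\sum_c e (j, c))%N.
have sumleg G : (\sum_(i in leg G) e i = \sum_(j in G) r j)%N.
  rewrite /r pair_big_dep /=; apply: eq_big => [[j c]|[j c] _] //=.
  by rewrite !inE andbT.
have sumall : (\sum_i e i = \sum_(j in [set: 'I_k]) r j)%N.
  rewrite -sumleg; apply: eq_bigl => i; by rewrite !inE.
move: deg; rewrite sumall (big_setID C1) /= setTI setTD (big_setID C2) /=.
rewrite [X in (_ + _ + X)%N](big_setID C2) /= (setIC (~: C1)) -setDE => deg.
rewrite !sumleg in l1 l2.
have {}l3 : (k.-1 * q.-1 * (#|C1 :&: C2| * d) <= 2 * k * \sum_(j in C1 :&: C2) r j)%N.
  rewrite -sum1_card big_distrl big_distrr /= big_distrr /=.
  apply: leq_sum => j /l3; rewrite mem_low -ltnNge sumleg big_set1 cards1.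
  by move/ltnW.
have c12 : (#|C1 :|: C2| = #|C1 :&: C2| + #|C1 :\: C2| + #|C2 :\: C1|)%N.
  rewrite cardsU -[#|C1|](cardsID C2) -[#|C2|](cardsID C1) (setIC C2).
  by move: #|_| #|_| #|_|; clear; lia.
have k12 : (#|C1 :|: C2| <= k)%N by rewrite -[leqRHS]card_ord max_card.
rewrite c12 in m12 k12; move: l1 l2 l3 deg m12 k12.
move: (\sum_(_ in C1 :&: C2) _)%N (\sum_(_ in C1 :\: C2) _)%N (\sum_(_ in C2 :\: C1) _)%N.
move: (\sum_(_ in ~: C1 :\: C2) _)%N #|C1 :&: C2| #|C1 :\: C2| #|C2 :\: C1| q.-1.
clear => z a b c Q x y w l1 l2 l3 deg m12 k12.
have t1 : (k.-1 * (a + b + c) * (d * Q) < 2 * k * m * (d * Q))%N.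
  apply: (@leq_trans (2 * k * (x + y + w))).
    have -> : (k.-1 * (a + b + c) * (d * Q) =
        k.-1 * Q * (a * d) + k.-1 * Q * (b * d) + k.-1 * Q * (c * d))%N by ring.
    by rewrite !mulnDr; move: l1 l2 l3; clear; lia.
  by rewrite -[leqRHS]mulnA leq_mul2l; apply/orP; right; move: deg; rewrite mulnA; clear; lia.
have {}t1 : (k.-1 * (a + b + c) < 2 * k * m)%N by move: t1; rewrite ltn_mul2r => /andP[].
move: m12 k12 t1; move: (a + b + c)%N => n; clear; case: k => [|k'] /=; first by lia.
by nia.
Qed.

End Box.

Import boot.fintype boot.finset.

(** * Contracting the indicator with weights to bound the solutions in a box *)

Section BoxBound.
Import boot.fintype boot.finset.
Local Open Scope ring_scope.
Variables (F : finFieldType) (m s k d : nat).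
Local Notation q := #|F|.
Local Notation exps := {ffun 'I_k * 'I_d -> 'I_q}.
Implicit Types (e : exps) (G C : {set 'I_k}) (Y Z : 'M[F]_(k, d)).
Variables (A : 'M[F]_(m, k)) (W : 'M[F]_(s, k)) (S : 'I_k -> {set 'rV[F]_d}).
Variables (C1 C2 : {set 'I_k}).

(* The rows outside [C1 :|: C2] are prescribed by [p]. *)
Definition box_solutions (p : 'M[F]_(k, d)) : {set 'M[F]_(k, d)} :=
  [set Y | [&& [forall j, row j Y \in S j], W *m Y == 0 &
    [forall j, (j \notin C1 :|: C2) ==> (row j Y == row j p)]]].

Hypothesis A_of_W : forall Y, W *m Y = 0 -> A *m Y = 0.
Hypothesis W_of_A : forall Y, (forall j, row j Y \in S j) -> A *m Y = 0 -> W *m Y = 0.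
Hypothesis det1 : forall Y, W *m Y = 0 -> (forall j, j \notin C1 -> row j Y = 0) -> Y = 0.
Hypothesis det2 : forall Y, W *m Y = 0 -> (forall j, j \notin C2 -> row j Y = 0) -> Y = 0.
Hypothesis m_lt : (2 * m < #|C1 :|: C2|)%N.

Local Notation E := (C1 :&: C2).
Local Notation G1 := (C2 :\: C1).
Local Notation G2 := (C1 :\: C2).

(** Off [E] the weight is concentrated at 0, so the sum over [z j] has a single term; one product
    over all rows can then describe a contraction in the rows of [E] only. *)
Lemma box_weights j : exists h : 'rV[F]_d -> F,
  if j \in E then
    [/\ forall x, x \notin S j -> h x = 0,
      forall e, restrict [set j] e \in low F d [set j] -> \sum_x h x * row_monomial e j x = 0 &
      (#|[set x in S j | h x == 0%R]| <= #|low F d [set j]|)%N]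
  else forall x, h x = (x == 0)%:R.
Proof.
have [jE|jE] := boolP (j \in E); last by exists (fun x => (x == 0)%:R).
have [h [h0 hphi hz]] := supported_orthogonal_weights (low F d [set j]) (S j)
  (fun e => row_monomial e j).
exists h; split=> // e /hphi.
move=> he; rewrite -[RHS]he; apply: eq_bigr => x _.
by rewrite row_monomial_restrict ?inE.
Qed.

Variable h : 'I_k -> 'rV[F]_d -> F.
Hypothesis hE : forall j, j \in E ->
    [/\ forall x, x \notin S j -> h j x = 0,
      forall e, restrict [set j] e \in low F d [set j] ->
        \sum_x h j x * row_monomial e j x = 0 &
      (#|[set x in S j | h j x == 0%R]| <= #|low F d [set j]|)%N].
Hypothesis hC : forall j, j \notin E -> forall x, h j x = (x == 0)%:R.

Variable p : 'M[F]_(k, d).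

Definition nonvanishing : {set 'M[F]_(k, d)} :=
  [set Y in box_solutions p | [forall j in E, h j (row j Y) != 0]].

Definition combine Y Y' (z : {ffun 'I_k -> 'rV[F]_d}) : 'M[F]_(k, d) :=
  \matrix_j if j \in E then z j else if j \in G2 then row j Y' else row j Y.

(* The contraction of the indicator of [A *m Y == 0] with the weights [h j],
   viewed as a matrix with rows indexed by [Y] and columns by [Y']. *)
Definition contraction Y Y' : F :=
  \sum_(z : {ffun 'I_k -> 'rV[F]_d}) (\prod_j h j (z j)) * (A *m combine Y Y' z == 0)%:R.

Lemma row_combine Y Y' z j :
  row j (combine Y Y' z) = if j \in E then z j else if j \in G2 then row j Y' else row j Y.
Proof. by rewrite rowK. Qed.

(** A nonzero term has its rows in the box, as [h j] vanishes off [S j], and solves [A], hence [W].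
    The combined matrix agrees with [Y] off [C1] and with [Y'] off [C2], so [det1] and [det2]
    identify it with both. *)
Lemma contraction_term Y Y' (z : {ffun 'I_k -> 'rV[F]_d}) : Y \in nonvanishing -> Y' \in nonvanishing ->
  (\prod_j h j (z j)) * (A *m combine Y Y' z == 0)%:R != 0 ->
  [/\ combine Y Y' z = Y, Y = Y' & forall j, j \notin E -> z j = 0].
Proof.
rewrite !inE => /andP[/and3P[/forallP YS /eqP WY /forallP Yp] _].
case/andP => /and3P[/forallP YS' /eqP WY' /forallP Yp'] _.
rewrite mulf_eq0 negb_or => /andP[/prodf_neq0 hz].
case: (A *m _ =P 0) => [AY _|_]; last by rewrite eqxx.
have WYc : W *m combine Y Y' z = 0.
  apply: W_of_A => // j; rewrite row_combine; case: ifP => jE; last by case: ifP.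
  have [hS _ _] := hE jE; rewrite -[_ \in S j]negbK; apply: contra (hz j isT) => /hS ->.
  by rewrite eqxx.
have e1 : combine Y Y' z = Y.
  apply/eqP; rewrite -subr_eq0; apply/eqP; apply: det1; first by rewrite mulmxBr WYc WY subrr.
  move=> j j1; rewrite raddfB /= row_combine !inE (negPf j1) andbF.
  by rewrite subrr.
have e2 : combine Y Y' z = Y'.
  apply/eqP; rewrite -subr_eq0; apply/eqP; apply: det2; first by rewrite mulmxBr WYc WY' subrr.
  move=> j j2; rewrite raddfB /= row_combine !inE (negPf j2) andbF /=.
  case: ifP => j1; first by rewrite subrr.
  have jC : j \notin C1 :|: C2 by rewrite inE j1 (negPf j2).
  by rewrite (eqP (implyP (Yp j) jC)) (eqP (implyP (Yp' j) jC)) subrr.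
split=> [//||j jE]; first by rewrite -[LHS]e1.
have := hz j isT; rewrite hC //.
by case: (z j =P 0) => // _; rewrite eqxx.
Qed.

Lemma contraction_diag Y Y' : Y \in nonvanishing -> Y' \in nonvanishing ->
  (contraction Y Y' != 0) = (Y == Y').
Proof.
move=> nY nY'; apply/idP/eqP => [nz|YY']; last subst Y'.
  have [/existsP[z]|no] := boolP [exists z : {ffun 'I_k -> 'rV[F]_d},
      (\prod_j h j (z j)) * (A *m combine Y Y' z == 0)%:R != 0].
    by move/(contraction_term nY nY') => [].
  move: nz; rewrite /contraction big1 ?eqxx // => z _; apply/eqP.
  by move: no; rewrite negb_exists => /forallP/(_ z); rewrite negbK.
(* On the diagonal this is the only [z] that contributes, and its term is a product of nonzero
   weights. *)
pose zs : {ffun 'I_k -> 'rV[F]_d} := [ffun j => if j \in E then row j Y else 0].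
have comb_zs : combine Y Y zs = Y.
  by apply/row_matrixP => j; rewrite row_combine ffunE if_same; case: (j \in E).
rewrite /contraction (bigD1 zs) //= [X in _ + X]big1 => [|z]; last first.
  apply: contra_neq_eq => /(contraction_term nY nY)[cY _ z0].
  apply/ffunP => j; rewrite ffunE; case: ifP => [jE|/negbT/z0 //].
  by rewrite -[in RHS]cY row_combine jE.
move: nY; rewrite !inE => /andP[/and3P[_ /eqP WY _] /forall_inP hY].
rewrite addr0 comb_zs A_of_W // eqxx mulr1; apply/prodf_neq0 => j _.
rewrite ffunE; case: ifP => jE; first exact: hY.
by rewrite hC ?jE // eqxx oner_eq0.
Qed.

Definition legs_monomial G e Y : F := \prod_(j in G) row_monomial e j (row j Y).

Definition weight e : F := \prod_(j in E) \sum_x h j x * row_monomial e j x.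

(** A monomial is a product over rows, so the sum over [z] factors row by row. *)
Lemma contraction_expand (c : exps -> F) Y Y' :
  (forall X : 'M[F]_(k, d), (A *m X == 0)%:R =
     \sum_e c e * \prod_j row_monomial e j (row j X)) ->
  contraction Y Y' =
  \sum_e c e * (weight e * (legs_monomial G2 e Y' * legs_monomial (~: C1) e Y)).
Proof.
move=> cE; rewrite /contraction; under eq_bigr do rewrite cE mulr_sumr.
rewrite exchange_big /=; apply: eq_bigr => e _.
under eq_bigr do rewrite mulrCA -big_split /=.
rewrite -mulr_sumr; congr (_ * _).
under eq_bigr do under eq_bigr do rewrite row_combine.
pose f j x := h j x * row_monomial e j
  (if j \in E then x else if j \in G2 then row j Y' else row j Y).
rewrite -(bigA_distr_bigA f) /= (bigID (mem E)) /=; congr (_ * _).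
  by apply: eq_bigr => j jE; apply: eq_bigr => x _; rewrite /f jE.
have fE j : j \notin E -> \sum_x f j x =
    row_monomial e j (if j \in G2 then row j Y' else row j Y).
  move=> jE; rewrite (bigD1 0) //= {1}/f hC // eqxx mul1r (negPf jE) big1 ?addr0 // => x x0.
  by rewrite /f hC // (negPf x0) mul0r.
rewrite (eq_bigr _ fE) (bigID (mem G2)) /=; congr (_ * _).
  apply: eq_big => [j|j /andP[_ ->] //]; rewrite !inE.
  by case: (j \in C1); case: (j \in C2).
apply: eq_big => [j|j /andP[_ /negPf ->] //]; rewrite !inE.
by case: (j \in C1); case: (j \in C2).
Qed.

Lemma legs_monomial_restrict G e Y : legs_monomial G (restrict G e) Y = legs_monomial G e Y.
Proof. by apply: eq_bigr => j jG; rewrite row_monomial_restrict. Qed.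

Lemma legs_monomial_setC e Y : Y \in nonvanishing ->
  legs_monomial (~: C1) e Y = legs_monomial G1 e Y * legs_monomial (~: (C1 :|: C2)) e p.
Proof.
rewrite !inE => /andP[/and3P[_ _ /forallP Yp] _].
rewrite /legs_monomial (big_setID C2) /= [~: C1 :\: C2]setDE -setCU (setIC _ C2) -setDE; congr (_ * _).
by apply: eq_bigr => j; rewrite in_setC => /(implyP (Yp j))/eqP ->.
Qed.

(** Monomials that are low on [G1] are grouped by their restriction to [G1], the remaining ones that
    are low on [G2] by their restriction to [G2]. By [low_leg] every other monomial is low on one
    row of [E], where the weight annihilates it. The rows prescribed by [p] only contribute scalars,
    absorbed in [K]. *)
Lemma card_nonvanishing : (#|nonvanishing| <= #|low F d G1| + #|low F d G2|)%N.
Proof.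
have [c cdeg cE] := row_indicator_poly d A.
pose K e := c e * weight e * legs_monomial (~: (C1 :|: C2)) e p.
pose P e := restrict G1 e \in low F d G1.
apply: (@card_le_of_diagonal _ _ _ _ _ _ (fun Y l => legs_monomial G1 l Y)
  (fun Y l => \sum_(e | ~~ P e && (restrict G2 e == l)) K e * legs_monomial G1 e Y)
  (fun l Y' => \sum_(e | P e && (restrict G1 e == l)) K e * legs_monomial G2 e Y')
  (fun l Y' => legs_monomial G2 l Y')) => Y Y' nY nY'.
rewrite -contraction_diag //; congr (_ != 0); rewrite (contraction_expand _ _ cE).
have termE e : c e * (weight e * (legs_monomial G2 e Y' * legs_monomial (~: C1) e Y)) =
    K e * (legs_monomial G1 e Y * legs_monomial G2 e Y').
  by rewrite legs_monomial_setC // /K; ring.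
rewrite (eq_bigr _ (fun e _ => termE e)) [RHS](bigID P) /=; congr (_ + _).
  rewrite [RHS](partition_big (restrict G1) (mem (low F d G1))) //=.
  apply: eq_bigr => l _; rewrite mulr_sumr; apply: eq_bigr => e /andP[_ /eqP <-].
  by rewrite legs_monomial_restrict mulrCA.
rewrite [RHS](bigID (fun e => restrict G2 e \in low F d G2)) /= [X in _ + X]big1 => [|e]; last first.
  case/andP=> nP1 nP2; have [c0|c0] := eqVneq (c e) 0; first by rewrite /K c0 !mul0r.
  have [j jE jlow] := low_leg m_lt (cdeg _ c0) nP1 nP2.
  have [_ /(_ _ jlow) hj _] := hE jE.
  by rewrite /K /weight (bigD1 j)//= hj mul0r mulr0 !mul0r.
rewrite addr0 [RHS](partition_big (restrict G2) (mem (low F d G2))) /=; last by move=> e /andP[].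
apply: eq_bigr => l lG2; rewrite mulr_suml; apply: eq_big => [e|e /andP[_ /eqP <-]].
  by rewrite -andbA; congr (_ && _); case: eqP => [->|]; rewrite ?lG2 ?andbF.
by rewrite legs_monomial_restrict mulrA.
Qed.

(** A solution outside [nonvanishing] has some row of [E] at one of the few zeros of the weight in
    [S j]; each such value accounts for at most [B] solutions. *)
Lemma card_box_solutions B :
  (forall j x, j \in E -> (#|[set Y in box_solutions p | row j Y == x]| <= B)%N) ->
  (#|box_solutions p| <= #|low F d G1| + #|low F d G2| + \sum_(j in E) #|low F d [set j]| * B)%N.
Proof.
move=> fiber.
pose Zr j := [set x in S j | h j x == 0].
have cover : box_solutions p \subset nonvanishing :|:
    \bigcup_(j in E) \bigcup_(x in Zr j) [set Y in box_solutions p | row j Y == x].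
  apply/subsetP => Y bY; rewrite in_setU; case: (boolP (Y \in nonvanishing)) => //= nY.
  have : ~~ [forall j in E, h j (row j Y) != 0] by move: nY; rewrite inE bY.
  rewrite negb_forall_in => /exists_inP[j jE]; rewrite negbK => hj.
  apply/bigcupP; exists j => //; apply/bigcupP; exists (row j Y); last by rewrite inE bY eqxx.
  by rewrite inE hj andbT; move: bY; rewrite inE => /and3P[/forallP].
have card_bigcup (T T' : finType) (D : {set T}) (f : T -> {set T'}) :
    (#|\bigcup_(x in D) f x| <= \sum_(x in D) #|f x|)%N.
  elim/big_rec2: _ => [|v c U _ Uc]; first by rewrite cards0.
  by apply: leq_trans (leq_card_setU _ _) _; rewrite leq_add2l.
apply: leq_trans (subset_leq_card cover) _; apply: leq_trans (leq_card_setU _ _) _.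
apply: leq_add card_nonvanishing _; apply: leq_trans (card_bigcup _ _ _ _) _.
apply: leq_sum => j jE; apply: leq_trans (card_bigcup _ _ _ _) _.
apply: (@leq_trans (\sum_(x in Zr j) B)); first by apply: leq_sum => x _; exact: fiber.
by rewrite sum_nat_const leq_mul2r; have [_ _ ->] := hE jE; rewrite orbT.
Qed.

End BoxBound.

(** * The number of solutions in a box *)

Section BoxCount.
Import boot.fintype boot.finset.
Local Open Scope ring_scope.
Variables (F : finFieldType) (k : nat).
Local Notation q := #|F|.

Lemma independent_columns s d (W : 'M[F]_(s, k)) C (Z : 'M[F]_(k, d)) :
  colrank W C = #|C| -> W *m Z = 0 -> (forall j, j \notin C -> row j Z = 0) -> Z = 0.
Proof.
move=> rC WZ Z0.
have ZC : colmask F C *m Z = Z.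
  apply/row_matrixP => j; apply/rowP => c; rewrite !mxE.
  have [jC|jC] := boolP (j \in C).
    rewrite (bigD1 j) //= !mxE eqxx jC mul1r big1 ?addr0 // => i /negPf ij.
    by rewrite !mxE eq_sym ij mulr0n mul0r.
  rewrite big1 => [|i _]; last by rewrite !mxE (negPf jC) mul0rn mul0r.
  by have /rowP/(_ c) := Z0 _ jC; rewrite !mxE.
have : (W *m colmask F C == colmask F C)%MS.
  rewrite -(mxrank_leqif_eq _) ?submxMl // rank_colmask.
  by apply/eqP; exact: rC.
case/andP => _ /submxP[Q QE].
by rewrite -ZC QE -!mulmxA ZC WZ mulmx0.
Qed.

Lemma rank_col_colmask s (W : 'M[F]_(s, k)) X :
  (colrank W X + #|~: X| <= \rank (col_mx W (colmask F (~: X))))%N.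
Proof.
rewrite -(rank_colmask F) /colrank.
have cap0 : (W *m colmask F X :&: colmask F (~: X))%MS = 0.
  apply/eqP/rowV0P => v; rewrite sub_capmx => /andP[/submxP[u vE] /submxP[t vE']].
  rewrite -[v]mulmx1 -(colmask_setC F X) mulmxDr {1}vE' vE -!mulmxA !colmask_mul.
  by rewrite (setIC (~: X)) setICr colmask0 !mulmx0 addr0.
rewrite -[leqLHS]mxrank_sum_cap cap0 mxrank0 addn0 -addsmxE; apply: mxrankS.
rewrite addsmx_sub addsmxSr andbT.
have -> : W *m colmask F X = W - W *m colmask F (~: X).
  by apply/eqP; rewrite eq_sym subr_eq -mulmxDr colmask_setC mulmx1.
by rewrite addmx_sub_adds // eqmx_opp submxMl.
Qed.

(** With [g] rows in each difference of the bases and [f] rows outside their union,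
    [k - \rank W = f + g]. The prescribed rows contribute [q ^ (f * d)]; both legs and each of the
    at most [k] rows in [C1 :&: C2] contribute at most [q ^ (g * d)] reduced by the saving, whence
    [k + 2]. *)
Lemma box_bound m s d e0 (A : 'M[F]_(m, k)) (W : 'M[F]_(s, k)) C1 C2
    (S : 'I_k -> {set 'rV[F]_d}) :
  (forall (I : finType) (D : {set I}),
    (#|low_exponents q k D| * q ^ (#|D| %/ e0) <= q ^ #|D|)%N) ->
  (A <= W)%MS -> (0 < \rank W)%N ->
  colrank W C1 = #|C1| /\ #|C1| = \rank W ->
  colrank W C2 = #|C2| /\ #|C2| = \rank W -> (2 * m < #|C1 :|: C2|)%N ->
  (forall j, j \in C1 :&: C2 -> colrank W ((C1 :|: C2) :\ j) = \rank W) ->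
  (forall Y : 'M[F]_(k, d), (forall j, row j Y \in S j) -> A *m Y = 0 -> W *m Y = 0) ->
  (#|[set Y : 'M[F]_(k, d) | [forall j, row j Y \in S j] && (W *m Y == 0%R)]| * q ^ (d %/ e0)
    <= (k + 2) * q ^ ((k - \rank W) * d))%N.
Proof.
move=> lowb AW W0 [iC1 sC1] [iC2 sC2] m12 exch W_of_A.
have q1 : (1 < q)%N by exact: card_finNzRing_gt1.
have A_of_W (Y : 'M[F]_(k, d)) : W *m Y = 0 -> A *m Y = 0.
  by case/submxP: AW => Q -> WY; rewrite -mulmxA WY mulmx0.
have [h h_prop] := fin_all_exists (box_weights S C1 C2).
have hE j : j \in C1 :&: C2 -> [/\ forall x, x \notin S j -> h j x = 0,
      forall e, restrict [set j] e \in low F d [set j] ->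
        \sum_x h j x * row_monomial e j x = 0 &
      (#|[set x in S j | h j x == 0%R]| <= #|low F d [set j]|)%N].
  by move=> jE; have := h_prop j; rewrite jE.
have hC j : j \notin C1 :&: C2 -> forall x, h j x = (x == 0)%:R.
  by move=> jE; have := h_prop j; rewrite (negPf jE).
have det C (iC : colrank W C = #|C|) (Y : 'M[F]_(k, d)) := @independent_columns s d W C Y iC.
pose g := #|C2 :\: C1|; pose f := #|~: (C1 :|: C2)|.
have gE : #|C1 :\: C2| = g.
  by rewrite /g !cardsD setIC sC1 sC2.
have [UE DE] : (#|C1 :|: C2| = \rank W + g /\ #|C1 :|: C2| + f = k)%N.
  split; last by rewrite cardsC card_ord.
  rewrite -sC1 /g cardsD cardsU setIC; have := subset_leq_card (subsetIl C2 C1).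
  by move: #|_| #|_| #|_|; clear; lia.
(* If the bases coincided, deleting an element from their union would lose rank, against [exch]. *)
have g0 : (0 < g)%N.
  rewrite lt0n cards_eq0 setD_eq0; apply/negP => C21.
  have eqC : C2 = C1 by apply/eqP; rewrite eqEcard C21 sC1 sC2 leqnn.
  have [j jC] : exists j, j \in C1 by apply/set0Pn; rewrite -card_gt0 sC1.
  have := exch j; rewrite eqC setIid setUid => /(_ jC) rj.
  have := rank_fun_le_card (C1 :\ j) (colrank_rank_fun W).
  by rewrite rj -sC1 [X in (X <= _)%N](cardsD1 j) jC ltnn.
have gE' : #|C2 :\: C1| = g by [].
clearbody f g.
have rE : (k - \rank W = f + g)%N by lia.
(* By [exch], [W] has full rank on the union without [j], so prescribing row [j] as well costs a
   full [d] dimensions. Differences of such solutions lie in the kernel of [N]. *)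
have fiber p j x : j \in C1 :&: C2 ->
    (#|[set Y in box_solutions W S C1 C2 p | row j Y == x]| <= q ^ ((g - 1) * d))%N.
  move=> jE; set T := [set Y in _ | _].
  have [->|[Y0 Y0T]] := set_0Vmem T; first by rewrite cards0.
  pose N := col_mx W (colmask F (~: ((C1 :|: C2) :\ j))).
  apply: (@leq_trans #|[set Y : 'M[F]_(k, d) | N *m Y == 0]|); last first.
    apply: card_kernel_le; have := rank_col_colmask W ((C1 :|: C2) :\ j); rewrite exch //.
    have jU : j \in C1 :|: C2 by move: jE; rewrite !inE => /andP[->].
    have := cardsC ((C1 :|: C2) :\ j); rewrite card_ord.
    have := cardsD1 j (C1 :|: C2); rewrite jU -/N.
    move: UE DE g0; move: (\rank N) (\rank W) #|~: (_ :\ _)| #|_ :\ _| #|C1 :|: C2|.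
    by clear; lia.
  rewrite -(card_imset _ (addrI (- Y0))); apply/subset_leq_card/subsetP => _ /imsetP[Y YT ->].
  move: YT Y0T; rewrite !inE => /andP[/and3P[_ /eqP WY /forallP Yp] /eqP Yx].
  case/andP => /and3P[_ /eqP WY0 /forallP Y0p] /eqP Y0x.
  rewrite mul_col_mx mulmxDr mulmxN WY WY0 oppr0 addr0.
  suff -> : colmask F (~: ((C1 :|: C2) :\ j)) *m (- Y0 + Y) = 0.
    by rewrite col_mx0.
  apply/matrixP => i c; rewrite colmask_mulmxE [RHS]mxE in_setC in_setD1.
  have eqrow : i \notin (C1 :|: C2) :\ j -> row i Y = row i Y0.
    rewrite in_setD1 negb_and negbK => /orP[/eqP ->|iU]; first by rewrite Yx Y0x.
    by rewrite (eqP (implyP (Yp i) iU)) (eqP (implyP (Y0p i) iU)).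
  rewrite -in_setD1; case: (boolP (i \in _)) => [_|/eqrow /rowP/(_ c)]; first by rewrite mul0r.
  by rewrite !mxE mul1r => ->; rewrite addNr.
pose B := (#|low F d (C2 :\: C1)| + #|low F d (C1 :\: C2)| +
  \sum_(j in C1 :&: C2) #|low F d [set j]| * q ^ ((g - 1) * d))%N.
have boxB p : (#|box_solutions W S C1 C2 p| <= B)%N.
  apply: (card_box_solutions A_of_W W_of_A (det _ iC1) (det _ iC2) m12 hE hC).
  by move=> j x; exact: fiber.
set Om := [set Y | _].
have OmB : (#|Om| <= q ^ (f * d) * B)%N.
  pose P := [set p : 'M[F]_(k, d) | colmask F (C1 :|: C2) *m p == 0].
  have cover : Om \subset \bigcup_(p in P) box_solutions W S C1 C2 p.
    apply/subsetP => Y; rewrite inE => /andP[YS WY].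
    apply/bigcupP; exists (colmask F (~: (C1 :|: C2)) *m Y).
      by rewrite inE mulmxA colmask_mul setICr colmask0 mul0mx.
    rewrite inE YS WY; apply/forallP => j; apply/implyP => jU; apply/eqP/rowP => c.
    by rewrite mxE [RHS]mxE colmask_mulmxE in_setC jU mul1r.
  apply: leq_trans (subset_leq_card cover) _.
  apply: (@leq_trans (\sum_(p in P) #|box_solutions W S C1 C2 p|)%N).
    elim/big_rec2: _ => [|v c U _ Uc]; first by rewrite cards0.
    by apply: leq_trans (leq_card_setU _ _) _; rewrite leq_add2l.
  apply: (@leq_trans (\sum_(p in P) B)%N); first by apply: leq_sum => p _; exact: boxB.
  rewrite sum_nat_const leq_mul2r; apply/orP; right; apply: card_kernel_le.
  by rewrite rank_colmask addnC DE.
apply: leq_trans (leq_mul OmB (leqnn _)) _.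
rewrite rE [((f + g) * d)%N]mulnDl expnD -mulnA [leqRHS]mulnCA leq_mul2l; apply/orP; right.
have lowQ (G : {set 'I_k}) : (0 < #|G|)%N -> (#|low F d G| * q ^ (d %/ e0) <= q ^ (#|G| * d))%N.
  move=> G0; have := lowb _ (leg d G); rewrite card_leg; apply: leq_trans.
  rewrite leq_mul2l; apply/orP; right.
  by rewrite leq_exp2l // leq_div2r // leq_pmull.
rewrite /B 2!mulnDl big_distrl /=.
have sumE : (\sum_(j in C1 :&: C2) #|low F d [set j]| * q ^ ((g - 1) * d) * q ^ (d %/ e0)
    <= #|C1 :&: C2| * q ^ (g * d))%N.
  rewrite -sum_nat_const; apply: leq_sum => j _; rewrite mulnAC.
  apply: leq_trans (leq_mul (lowQ [set j] _) (leqnn _)) _; first by rewrite cards1.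
  by rewrite cards1 mul1n -expnD -mulSn subn1 prednK.
have := lowQ (C2 :\: C1); rewrite gE' => /(_ g0) l1; have := lowQ (C1 :\: C2); rewrite gE => /(_ g0) l2.
apply: (@leq_trans (q ^ (g * d) + q ^ (g * d) + #|C1 :&: C2| * q ^ (g * d)))%N.
  by apply: leq_add sumE; apply: leq_add.
have kE : (#|C1 :&: C2| <= k)%N by rewrite -[leqRHS]card_ord max_card.
rewrite mulnDl mul2n addnn addnC leq_add2r leq_mul2r kE orbT //.
Qed.

End BoxCount.

(** * Random fibres *)

Section Sampling.
Import boot.fintype boot.finset.
Local Open Scope ring_scope.
Variables (F : finFieldType) (k : nat).
Local Notation q := #|F|.

Definition inside n (S : {set 'rV[F]_n}) (X : 'M[F]_(k, n)) : bool := [forall j, row j X \in S].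

(** The rows of [X - X0] lie in the kernel of [h]. Their coordinates in a basis of it embed the
    fibre into a box whose sides are translated slices of [S]. *)
Lemma fiber_bound s n l (W : 'M[F]_(s, k)) (X0 : 'M[F]_(k, n)) (h : 'M[F]_(n, l))
    (S : {set 'rV[F]_n}) : W *m X0 = 0 ->
  (#|[set X | [&& inside S X, W *m X == 0%R & X *m h == X0 *m h]]| <=
   #|[set Y : 'M[F]_(k, \rank (kermx h)) |
      [forall j, row j Y \in [set y | (row j X0 + y *m row_base (kermx h))%R \in S]] &&
      (W *m Y == 0%R)]|)%N.
Proof.
move=> WX0; set K := row_base (kermx h).
pose f (X : 'M[F]_(k, n)) := (X - X0) *m pinvmx K.
have fK X : X *m h == X0 *m h -> f X *m K = X - X0.
  move=> Xh; apply: mulmxKpV; rewrite eq_row_base; apply/sub_kermxP.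
  by rewrite mulmxBl (eqP Xh) subrr.
have finj : {in [set X | [&& inside S X, W *m X == 0%R & X *m h == X0 *m h]] &, injective f}.
  move=> X X'; rewrite !inE => /and3P[_ _ /fK eX] /and3P[_ _ /fK eX'] ff.
  by apply: (addIr (- X0)); rewrite -eX ff eX'.
rewrite -(card_in_imset finj); apply/subset_leq_card/subsetP => _ /imsetP[X XT ->].
move: XT; rewrite !inE => /and3P[/forallP XS /eqP WX /fK fX]; apply/andP; split.
  by apply/forallP => j; rewrite inE -row_mul fX raddfB /= addrCA subrr addr0.
by rewrite mulmxA mulmxBr WX WX0 subrr mul0mx.
Qed.

Lemma fiber_bound_trivial s n l (W : 'M[F]_(s, k)) (u : 'M[F]_(k, l)) (h : 'M[F]_(n, l))
    (S : {set 'rV[F]_n}) : \rank h = l ->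
  (#|[set X | [&& inside S X, W *m X == 0%R & X *m h == u]]| <= q ^ ((k - \rank W) * (n - l)))%N.
Proof.
move=> rh; set T := [set X | _].
have [->|[X0 X0T]] := set_0Vmem T; first by rewrite cards0.
move: (X0T); rewrite inE => /and3P[_ /eqP WX0 /eqP X0h].
rewrite /T -X0h; apply: leq_trans (fiber_bound h S WX0) _.
apply: leq_trans (_ : #|[set Y : 'M[F]_(k, \rank (kermx h)) | W *m Y == 0%R]| <= _)%N.
  by apply/subset_leq_card/subsetP => Y; rewrite !inE => /andP[].
by rewrite card_kernel mxrank_ker rh.
Qed.

Lemma fiber_bound_clean m s n l e0 (A : 'M[F]_(m, k)) (W : 'M[F]_(s, k)) C1 C2
    (u : 'M[F]_(k, l)) (h : 'M[F]_(n, l)) (S : {set 'rV[F]_n}) :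
  (forall (I : finType) (D : {set I}),
    (#|low_exponents q k D| * q ^ (#|D| %/ e0) <= q ^ #|D|)%N) ->
  (A <= W)%MS -> (0 < \rank W)%N ->
  colrank W C1 = #|C1| /\ #|C1| = \rank W ->
  colrank W C2 = #|C2| /\ #|C2| = \rank W -> (2 * m < #|C1 :|: C2|)%N ->
  (forall j, j \in C1 :&: C2 -> colrank W ((C1 :|: C2) :\ j) = \rank W) ->
  \rank h = l ->
  (forall X, inside S X -> A *m X = 0 -> X *m h = u -> W *m X = 0) ->
  (#|[set X | [&& inside S X, W *m X == 0%R & X *m h == u]]| * q ^ ((n - l) %/ e0) <=
   (k + 2) * q ^ ((k - \rank W) * (n - l)))%N.
Proof.
move=> lowb AW W0 b1 b2 m12 exch rh clean; set T := [set X | _].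
have [->|[X0 X0T]] := set_0Vmem T; first by rewrite cards0 mul0n.
move: (X0T); rewrite inE => /and3P[_ /eqP WX0 /eqP X0h].
have AX0 : A *m X0 = 0 by case/submxP: AW => Q ->; rewrite -mulmxA WX0 mulmx0.
have := mxrank_ker h; rewrite rh => <-.
pose Sh j := [set y | (row j X0 + y *m row_base (kermx h))%R \in S].
apply: leq_trans (_ : _ <= _ * q ^ (\rank (kermx h) %/ e0))%N
  (box_bound (S := Sh) lowb AW W0 b1 b2 m12 exch _).
  by rewrite leq_mul2r; apply/orP; right; rewrite /T -X0h; exact: fiber_bound h S WX0.
move=> Y YS AY; apply: (row_free_inj (row_base_free (kermx h))).
rewrite /= mul0mx -mulmxA.
have KH : row_base (kermx h) *m h = 0 by apply/sub_kermxP; rewrite eq_row_base.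
have : W *m (X0 + Y *m row_base (kermx h)) = 0.
  apply: clean.
  - by apply/forallP => j; have := YS j; rewrite inE raddfD /= row_mul.
  - by rewrite mulmxDr AX0 add0r mulmxA AY mul0mx.
  - by rewrite mulmxDl X0h -mulmxA KH mulmx0 addr0.
by rewrite mulmxDr WX0 add0r.
Qed.

(* Average over all surjective [h] and all [u] with [W *m u = 0] the bound of
   [fiber_bound_clean] (no bad [X] in the fibre) or [fiber_bound_trivial]. *)
Lemma sampling m s n l e0 (A : 'M[F]_(m, k)) (W : 'M[F]_(s, k)) C1 C2 (S : {set 'rV[F]_n}) :
  (forall (I : finType) (D : {set I}),
    (#|low_exponents q k D| * q ^ (#|D| %/ e0) <= q ^ #|D|)%N) ->
  (A <= W)%MS -> (0 < \rank W)%N ->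
  colrank W C1 = #|C1| /\ #|C1| = \rank W ->
  colrank W C2 = #|C2| /\ #|C2| = \rank W -> (2 * m < #|C1 :|: C2|)%N ->
  (forall j, j \in C1 :&: C2 -> colrank W ((C1 :|: C2) :\ j) = \rank W) ->
  (l < n)%N ->
  (q ^ (n * l) * (#|[set X | inside S X && (W *m X == 0%R)]| * q ^ ((n - l) %/ e0)) <=
   q ^ (n * l) * ((k + 2) * q ^ ((k - \rank W) * n)) +
   2 * (q ^ ((n - l) %/ e0) * q ^ ((k - \rank W) * (n - l)) *
   \sum_(X | [&& inside S X, A *m X == 0%R & W *m X != 0%R]) q ^ ((n - \rank (W *m X)) * l)))%N.
Proof.
move=> lowb AW W0 b1 b2 m12 exch ln.
set Q := (q ^ ((n - l) %/ e0))%N; set r := (k - \rank W)%N.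
pose Hs := [set h : 'M[F]_(n, l) | \rank h == l].
pose U := [set u : 'M[F]_(k, l) | W *m u == 0%R].
pose good (h : 'M[F]_(n, l)) (u : 'M[F]_(k, l)) := #|[set X | [&& inside S X, W *m X == 0%R & X *m h == u]]|.
pose badp (X : 'M[F]_(k, n)) := [&& inside S X, A *m X == 0%R & W *m X != 0%R].
pose bad (h : 'M[F]_(n, l)) (u : 'M[F]_(k, l)) := #|[set X | badp X && (X *m h == u)]|.
set Gd := #|[set X | _]|.
have goodsum h : (\sum_(u in U) good h u = Gd)%N.
  rewrite /Gd -sum1_card (partition_big (fun X => X *m h) (mem U)) /=; last first.
    by move=> X; rewrite !inE => /andP[_ /eqP WX]; rewrite mulmxA WX mul0mx.
  by apply: eq_bigr => u _; rewrite /good -sum1_card; apply: eq_bigl => X; rewrite !inE andbA.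
(* A fibre with a bad [X] only gets the trivial bound, which is charged to its [bad h u >= 1] bad
   elements. *)
have goodle h u : h \in Hs -> (good h u * Q <= (k + 2) * q ^ (r * (n - l)) +
    Q * q ^ (r * (n - l)) * bad h u)%N.
  rewrite inE => /eqP rh; have [b0|bpos] := posnP (bad h u).
    rewrite b0 muln0 addn0; apply: (fiber_bound_clean lowb AW W0 b1 b2 m12 exch rh) => X XS AX Xh.
    apply/eqP/negPn/negP => WX; have /eqP := b0; rewrite cards_eq0.
    by move=> /eqP/setP/(_ X); rewrite !inE /badp XS AX Xh WX !eqxx.
  apply: leq_trans (leq_addl _ _); apply: (@leq_trans (Q * q ^ (r * (n - l)))%N).
    by rewrite mulnC leq_mul2l fiber_bound_trivial ?orbT.
  by rewrite leq_pmulr.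
have hle h : h \in Hs -> (Gd * Q <= (k + 2) * q ^ (r * n) + Q * q ^ (r * (n - l)) *
    #|[set X | badp X && (W *m X *m h == 0%R)]|)%N.
  move=> hH; rewrite -(goodsum h) big_distrl /=.
  apply: (@leq_trans (\sum_(u in U) ((k + 2) * q ^ (r * (n - l)) +
      Q * q ^ (r * (n - l)) * bad h u))%N); first by apply: leq_sum => u _; exact: goodle.
  rewrite big_split /= sum_nat_const card_kernel -/r.
  apply: leq_add.
    by rewrite mulnCA leq_mul2l -expnD -mulnDr subnKC ?leqnn ?orbT // ltnW.
  rewrite -big_distrr leq_mul2l; apply/orP; right.
  rewrite -sum1_card (partition_big (fun X => X *m h) (mem U)) /=; last first.
    by move=> X; rewrite !inE mulmxA => /andP[].
  apply: leq_sum => u; rewrite inE => /eqP Wu; rewrite /bad -sum1_card.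
  apply/eq_leq/eq_bigl => X; rewrite !inE -mulmxA.
  by case: (X *m h =P u) => [->|_]; rewrite ?andbF // Wu eqxx !andbT.
(* Exchanging the sums, a bad [X] is counted for the [h] with [W *m X *m h = 0], at most
   [q ^ ((n - \rank (W *m X)) * l)] in number. *)
have total : (#|Hs| * (Gd * Q) <= #|Hs| * ((k + 2) * q ^ (r * n)) +
    Q * q ^ (r * (n - l)) * \sum_(X | badp X) q ^ ((n - \rank (W *m X)) * l))%N.
  rewrite -![(#|Hs| * _)%N]sum_nat_const.
  apply: (@leq_trans (\sum_(h in Hs) ((k + 2) * q ^ (r * n) + Q * q ^ (r * (n - l)) *
      #|[set X | badp X && (W *m X *m h == 0%R)]|))%N); first by apply: leq_sum => h; exact: hle.
  rewrite big_split /= leq_add2l -big_distrr leq_mul2l; apply/orP; right.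
  under eq_bigr do rewrite -sum1_card.
  rewrite (exchange_big_dep badp) /=; last by move=> h X _; rewrite inE => /andP[].
  apply: leq_sum => X bX; rewrite -card_kernel -sum1_card.
  rewrite big_mkcond [leqRHS]big_mkcond /=; apply: leq_sum => h _.
  by rewrite !inE bX /=; case: (_ == l); case: (_ == 0).
have := card_surjective F ln; rewrite -/Hs => H2.
(* Only when the difference of the two sides is positive is [#|Hs|] replaced by its lower bound,
   half of [q ^ (n * l)]. *)
have [le|lt] := leqP (Gd * Q) ((k + 2) * q ^ (r * n)).
  by apply: leq_trans (leq_addr _ _); rewrite leq_mul2l le orbT.
rewrite -leq_subLR -mulnBr; apply: leq_trans (leq_mul H2 (leqnn _)) _.
by rewrite -mulnA leq_mul2l /= mulnBr leq_subLR.
Qed.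

End Sampling.

(** * The rank increment *)

Section Increment.
Import boot.fintype boot.finset.
Local Open Scope ring_scope.

(** Here [t] is the saving from boxes, [p] the loss assumed at rank [r], [v] the gain from rarity at
    higher ranks, [G] the number of solutions of [W] and [SB] the sum over bad [X]. Chaining the
    inequalities bounds [M] by three terms, each at most a quarter of [M]. *)
Lemma counting_contradiction (q k n l d r t p v G SB : nat) :
  (1 < q)%N -> (0 < n)%N -> (r <= k)%N -> (8 * (k + 2) + 2 * (k * k) + p <= t)%N ->
  (8 * (k + 2) + 2 * (k * k) + p + k * d <= l)%N ->
  (8 * (k + 2) + 2 * (k * k) + p + k * d <= v)%N ->
  (q ^ (n * l) * (G * q ^ t) <=
    q ^ (n * l) * ((k + 2) * q ^ (r * n)) + 2 * (q ^ t * q ^ (r * d) * SB))%N ->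
  (q ^ v * SB <= q ^ (v + k * k + r * n + (n - 1) * l) + k * q ^ (n * l + r * n + (k - r) * d))%N ->
  (q ^ (r * n) <= q ^ (k * k) * G * q ^ p)%N -> False.
Proof.
move=> q1 n0 rk pt pl pv H1 H2 H3.
have kd : (r * d + (k - r) * d = k * d)%N by rewrite -mulnDl subnKC.
have nl : ((n - 1) * l + l = n * l)%N by rewrite -mulSnr subn1 prednK.
have rd : (r * d <= k * d)%N by rewrite leq_mul2r rk orbT.
pose M := (q ^ (n * l + r * n + t + v))%N.
have M0 : (0 < M)%N by rewrite expn_gt0 ltnW.
have term c x : (c <= 8 * (k + 2))%N -> (8 * (k + 2) + x <= n * l + r * n + t + v)%N ->
    (c * q ^ x <= M)%N.
  move=> cb xM; apply: (@leq_trans (q ^ (8 * (k + 2)) * q ^ x)%N).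
    by rewrite leq_mul2r (leq_trans cb) ?orbT // ltnW // ltn_expl.
  by rewrite -expnD leq_exp2l.
have T1 : (4 * (k + 2) * q ^ (k * k + p + v + n * l + r * n) <= M)%N by apply: term; lia.
have T2 : (8 * q ^ (k * k + p + t + r * d + (v + k * k + r * n + (n - 1) * l)) <= M)%N.
  by apply: term; lia.
have T3 : (8 * k * q ^ (k * k + p + t + r * d + (n * l + r * n + (k - r) * d)) <= M)%N.
  by apply: term; lia.
have H4 : (M <= q ^ (k * k + p) * q ^ v * (q ^ (n * l) * (G * q ^ t)))%N.
  have -> : (q ^ (k * k + p) * q ^ v * (q ^ (n * l) * (G * q ^ t)) =
      q ^ (k * k) * G * q ^ p * (q ^ (n * l) * q ^ t * q ^ v))%N by rewrite expnD; ring.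
  have -> : M = (q ^ (r * n) * (q ^ (n * l) * q ^ t * q ^ v))%N by rewrite /M !expnD; ring.
  by rewrite leq_mul2r H3 orbT.
have H5 : (M <= q ^ (k * k + p) * q ^ v * (q ^ (n * l) * ((k + 2) * q ^ (r * n))) +
    2 * (q ^ (k * k + p) * q ^ t * q ^ (r * d)) * (q ^ v * SB))%N.
  apply: leq_trans H4 _; apply: leq_trans (leq_mul (leqnn _) H1) _.
  by apply: eq_leq; ring.
have H6 := leq_trans H5 (leq_add (leqnn _) (leq_mul (leqnn _) H2)).
have e1 : (q ^ (k * k + p) * q ^ v * (q ^ (n * l) * ((k + 2) * q ^ (r * n))) =
    (k + 2) * q ^ (k * k + p + v + n * l + r * n))%N by rewrite !expnD; ring.
have e2 : (2 * (q ^ (k * k + p) * q ^ t * q ^ (r * d)) *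
    (q ^ (v + k * k + r * n + (n - 1) * l) + k * q ^ (n * l + r * n + (k - r) * d)) =
    2 * q ^ (k * k + p + t + r * d + (v + k * k + r * n + (n - 1) * l)) +
    2 * k * q ^ (k * k + p + t + r * d + (n * l + r * n + (k - r) * d)))%N.
  by rewrite !expnD; ring.
rewrite e1 e2 in H6; move: H6 T1 T2 T3 M0; clear.
set a := (_ ^ _)%N; set b := (_ ^ _)%N; set c := (_ ^ _)%N; move: M a b c; clear.
move=> M a b c; rewrite -!mulnA; move: ((k + 2) * a)%N (k * c)%N => u w; lia.
Qed.

Variables (F : finFieldType) (m k : nat) (A : 'M[F]_(m, k)).
Local Notation q := #|F|.
Local Notation ones := (const_mx 1 : 'cV[F]_k).

(* The rank is one more than the dimension of the affine span of the rows. *)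
Definition affine n (X : 'M[F]_(k, n)) : 'M[F]_(k, n + 1) := row_mx X ones.

Definition solutions n (S : {set 'rV[F]_n}) (r : nat) : {set 'M[F]_(k, n)} :=
  [set X | [&& inside S X, A *m X == 0 & \rank (affine X) == r]].

Lemma card_rank_affine_le n r : (r <= k)%N ->
  (#|[set X : 'M[F]_(k, n) | (\rank (affine X) <= r)%N]| <= q ^ (k * k + r * n))%N.
Proof.
move=> rk.
have cover : [set X : 'M[F]_(k, n) | (\rank (affine X) <= r)%N] \subset
    \bigcup_(W : 'M[F]_k | (k <= r + \rank W)%N) [set X : 'M[F]_(k, n) | W *m X == 0].
  apply/subsetP => X; rewrite inE => Xr; apply/bigcupP; exists (kermx (affine X)).
    by rewrite mxrank_ker -leq_subLR leq_sub2l.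
  rewrite inE; have := mulmx_ker (affine X); rewrite /affine mul_mx_row -[0]hsubmxK.
  by case/eq_row_mx => -> _; apply/eqP/matrixP => i j; rewrite !mxE.
apply: leq_trans (subset_leq_card cover) _.
apply: (@leq_trans (\sum_(W : 'M[F]_k | (k <= r + \rank W)%N) q ^ (r * n))%N).
  elim/big_rec2: _ => [|W c U kW Uc]; first by rewrite cards0.
  by apply: leq_trans (leq_card_setU _ _) _; apply: leq_add => //; exact: card_kernel_le.
rewrite sum_nat_const expnD leq_mul2r; apply/orP; right.
by rewrite -card_mx max_card.
Qed.

Lemma rank_bad s n (W : 'M[F]_(s, k)) (X : 'M[F]_(k, n)) : W *m ones = 0 ->
  (\rank (affine X) <= (k - \rank W) + \rank (W *m X))%N.
Proof.
move=> W1; have := mxrank_mul_min W (affine X).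
have : (\rank (W *m affine X) <= \rank (W *m X))%N.
  rewrite /affine mul_mx_row W1 -[row_mx _ _]mulmx1.
  by rewrite -[X in (X <= _)%N]mxrank_tr mulmx1 tr_row_mx trmx0 -addsmxE addsmx0 mxrank_tr.
have := rank_leq_col W.
by move: (\rank (W *m affine X)) (\rank (affine X)) (\rank W) (\rank _); clear; lia.
Qed.

(** Bad [X] of affine rank at most [r] are few in total, and [W *m X] has rank at least 1. At affine
    rank [r' > r] they are rare by assumption, and [W *m X] has rank at least [r' - r], so few [h]
    kill it. *)
Lemma bad_sum n l d a' s (W : 'M[F]_(s, k)) (S : {set 'rV[F]_n}) :
  W *m ones = 0 -> n = (l + d)%N -> (0 < n)%N -> (k <= n)%N ->
  (forall r', (k - \rank W < r')%N -> (r' <= k)%N ->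
     (#|solutions S r'| * q ^ (n %/ a') <= q ^ (r' * n))%N) ->
  (q ^ (n %/ a') *
    (\sum_(X | [&& inside S X, A *m X == 0%R & W *m X != 0%R]) q ^ ((n - \rank (W *m X)) * l)) <=
   q ^ (n %/ a' + k * k + (k - \rank W) * n + (n - 1) * l) +
   k * q ^ (n * l + (k - \rank W) * n + (k - (k - \rank W)) * d))%N.
Proof.
move=> W1 nE n0 kn few; set r := (k - \rank W)%N; set V := (q ^ (n %/ a'))%N.
have q0 : (0 < q)%N by apply/card_gt0P; exists 0.
pose badp (X : 'M[F]_(k, n)) := [&& inside S X, A *m X == 0 & W *m X != 0].
rewrite (bigID (fun X => (\rank (affine X) <= r)%N)) /= mulnDr; apply: leq_add.
  rewrite -!addnA expnD leq_mul2l; apply/orP; right; rewrite addnA expnD.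
  apply: (@leq_trans (\sum_(X in [set X : 'M[F]_(k, n) | (\rank (affine X) <= r)%N])
      q ^ ((n - 1) * l))%N).
    rewrite big_mkcond [leqRHS]big_mkcond /=; apply: leq_sum => X _; rewrite inE.
    case: ifP => // /andP[/and3P[_ _ WX] ->].
    rewrite leq_pexp2l // leq_mul2r leq_sub2l ?orbT // lt0n mxrank_eq0 //.
  rewrite sum_nat_const leq_mul2r card_rank_affine_le ?orbT //.
  exact: leq_subr.
have rW : (\rank W <= k)%N by exact: rank_leq_col.
apply: (@leq_trans (V * \sum_(r' < k.+1 | (r < r')%N) (#|solutions S r'| * q ^ ((n - (r' - r)) * l)))%N).
  rewrite leq_mul2l; apply/orP; right.
  rewrite (partition_big (fun X => inord (\rank (affine X)) : 'I_k.+1)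
    (fun r' => (r < r')%N)) /=; last first.
    by move=> X /andP[_]; rewrite -ltnNge inordK // ltnS rank_leq_row.
  apply: leq_sum => r' rr'; rewrite -sum_nat_const big_mkcond [leqRHS]big_mkcond /=.
  apply: leq_sum => X _; rewrite inE.
  case: ifP => // /andP[/andP[/and3P[-> -> WX] _] /eqP rX].
  have -> : \rank (affine X) = r' by rewrite -rX inordK // ltnS rank_leq_row.
  rewrite eqxx /= leq_pexp2l // leq_mul2r leq_sub2l ?orbT //.
  have := rank_bad X W1; rewrite -/r.
  have -> : \rank (affine X) = r' by rewrite -rX inordK // ltnS rank_leq_row.
  by move: (\rank _) rr'; clear; lia.
rewrite big_distrr /=; apply: (@leq_trans (\sum_(r' < k.+1 | (r < r')%N)
    q ^ (n * l + r * n + (k - r) * d))%N).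
  apply: leq_sum => r' rr'; rewrite mulnCA mulnA [(_ * V)%N]mulnC -[(V * _)%N]mulnC.
  apply: leq_trans (leq_mul (few r' rr' _) (leqnn _)) _; first by rewrite -ltnS.
  rewrite -expnD leq_exp2l ?card_finNzRing_gt1 //.
  have r'k : (r' <= k)%N by rewrite -ltnS.
  have eqn : (r' * n + (n - (r' - r)) * l = n * l + r * n + (r' - r) * d)%N.
    have dn : ((r' - r) * n = (r' - r) * l + (r' - r) * d)%N by rewrite nE mulnDr.
    have rn : (r' * n = r * n + (r' - r) * n)%N by rewrite -mulnDl subnKC // ltnW.
    have nl : (n * l = (r' - r) * l + (n - (r' - r)) * l)%N.
      by rewrite -mulnDl subnKC // (leq_trans (leq_subr _ _)) // (leq_trans r'k).
    by move: dn rn nl; clear; lia.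
  by rewrite eqn leq_add2l leq_mul2r leq_sub2r ?orbT.
rewrite sum_nat_const leq_mul2r; apply/orP; right.
apply: (@leq_trans #|predC1 (ord0 : 'I_k.+1)|); last by rewrite cardC1 card_ord.
apply/subset_leq_card/subsetP => i; rewrite !inE -lt0n; exact: leq_trans.
Qed.

End Increment.

(** * Raising the rank until a generic solution appears *)

Section Conclusion.
Import boot.fintype boot.finset.
Local Open Scope ring_scope.
Variables (R : realType) (F : finFieldType) (m k : nat) (A : 'M[F]_(m, k)).
Local Notation q := #|F|.
Local Notation ones := (const_mx 1 : 'cV[F]_k).
Hypotheses (A_ones : A *m ones = 0) (rankA : \rank A = m) (tameA : tame A).

(** Pigeonhole over the at most [q ^ (k * k)] possible values of [kermx (affine X)]. *)
Lemma popular_kernel n (S : {set 'rV[F]_n}) r : (0 < #|solutions A S r|)%N ->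
  exists W : 'M[F]_k, [/\ (A <= W)%MS, W *m ones = 0, (\rank W = k - r)%N &
    (#|solutions A S r| <= q ^ (k * k) * #|[set X | inside S X && (W *m X == 0%R)]|)%N].
Proof.
move=> N0; pose f (W : 'M[F]_k) := #|[set X in solutions A S r | kermx (affine X) == W]|.
pose W := [arg max_(W > 0) f W].
have Wmax V : (f V <= f W)%N by rewrite /W; case: arg_maxnP => // V' _; apply.
have Nle : (#|solutions A S r| <= q ^ (k * k) * f W)%N.
  rewrite -card_mx -sum1_card (partition_big (fun X => kermx (affine X)) predT) //=.
  rewrite -sum_nat_const; apply: leq_sum => V _.
  apply: leq_trans (Wmax V); rewrite /f -sum1_card; apply/eq_leq/eq_bigl => X.
  by rewrite !inE.
have [X] : exists X, X \in [set X in solutions A S r | kermx (affine X) == W].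
  by apply/set0Pn; rewrite -card_gt0 -/(f W) lt0n; apply: contraTneq (leq_trans N0 Nle) => ->;
     rewrite muln0.
rewrite !inE => /andP[/and3P[_ /eqP AX /eqP rX] /eqP WE].
have kerE (Z : 'M[F]_(k, n)) : kermx (affine Z) *m Z = 0 /\ kermx (affine Z) *m ones = 0.
  have := mulmx_ker (affine Z); rewrite /affine mul_mx_row => H.
  by split; [rewrite -[LHS](row_mxKl _ (kermx (affine Z) *m ones))|
             rewrite -[LHS](row_mxKr (kermx (affine Z) *m Z))]; rewrite /affine H ?linear0.
exists W; split.
- by rewrite -WE; apply/sub_kermxP; rewrite /affine mul_mx_row AX A_ones row_mx0.
- by rewrite -WE; case: (kerE X).
- by rewrite -WE mxrank_ker rX.
apply: leq_trans Nle _; rewrite leq_mul2l; apply/orP; right.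
apply/subset_leq_card/subsetP => Z; rewrite !inE => /andP[/and3P[-> _ _] /eqP <-].
by apply/eqP; case: (kerE Z).
Qed.

(** If no larger rank had many solutions, [bad_sum] would make the bad matrices for a popular [W]
    rare, and [sampling] would leave too few solutions of [W]. *)
Lemma increment r a' : (r + m < k)%N -> (0 < a')%N ->
  exists a n0, [/\ (a' <= a)%N, (0 < a)%N & forall n (S : {set 'rV[F]_n}), (n0 <= n)%N ->
    (q ^ (r * n) <= #|solutions A S r| * q ^ (n %/ a))%N ->
    exists2 r', (r < r')%N & (q ^ (r' * n) <= #|solutions A S r'| * q ^ (n %/ a'))%N].
Proof.
move=> rmk a'0; have q1 : (1 < q)%N by exact: card_finNzRing_gt1.
have k0 : (0 < k)%N by apply: leq_ltn_trans rmk.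
have [e0 e00 lowb] := card_low_exponents R q1 k0.
have [c cE] : exists c, c = (8 * (k + 2) + 2 * (k * k))%N by eexists.
(* For [d = n %/ b] this gives [(k + 5) * d <= n %/ a'], room for the loss [k * d] and the constants
   in [c]. The factor [e0 * 2] below makes the tolerated loss half of the saving [d %/ e0], and the
   threshold for [n] ensures [2 * c <= d %/ e0]. *)
pose b := (a' * (k + 5))%N.
exists (b * (e0 * 2))%N, (b * (e0 * (2 * c)) + k).+1; split.
- by rewrite /b -mulnA leq_pmulr // !muln_gt0 addn_gt0 e00 orbT.
- by rewrite /b !muln_gt0 a'0 e00 addn_gt0 orbT.
move=> n S nn0 Nr.
have [/existsP[r' /andP[rr' H]]|few] := boolP [exists r' : 'I_k.+1, (r < r')%N &&
    (q ^ (r' * n) <= #|solutions A S r'| * q ^ (n %/ a'))%N]; first by exists r'.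
have {}few r' : (r < r')%N -> (r' <= k)%N ->
    (#|solutions A S r'| * q ^ (n %/ a') <= q ^ (r' * n))%N.
  move=> rr' r'k; move: few; rewrite negb_exists => /forallP/(_ (Ordinal (r'k : (r' < k.+1)%N))).
  by rewrite /= rr' /= -ltnNge => /ltnW.
have N0 : (0 < #|solutions A S r|)%N.
  rewrite lt0n; apply: contraTneq Nr => ->.
  by rewrite mul0n -ltnNge expn_gt0 (ltnW q1).
have [W [AW W1 rW NW]] := popular_kernel N0.
have rWk : (k - \rank W = r)%N by rewrite rW; move: rmk; clear; lia.
have mW : (m < \rank W)%N by rewrite rW; move: rmk; clear; lia.
have [C1 [C2 [b1 b2 m12 exch]]] := good_base_pair rankA tameA AW mW (fun j => colrank_setC1 j W1).
pose d := (n %/ b)%N; pose l := (n - d)%N.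
have b0 : (0 < b)%N by rewrite /b muln_gt0 a'0 addn_gt0 orbT.
have bd : (b * d <= n)%N by rewrite mulnC leq_divM.
have b5 : (k + 5 <= b)%N by rewrite /b leq_pmull.
have t2c : (2 * c <= d %/ e0)%N.
  rewrite leq_divRL // leq_divRL //; apply: leq_trans (ltnW nn0).
  by rewrite [X in (_ <= X + _)%N]mulnC [(e0 * _)%N]mulnC leq_addr.
have td : (d %/ e0 <= d)%N by exact: leq_div.
have kn : (k <= n)%N by move: nn0; clear; lia.
have n0 : (0 < n)%N by apply: leq_trans kn.
have bd5 : ((k + 5) * d <= n)%N by apply: leq_trans bd; rewrite leq_mul2r b5 orbT.
have d0 : (0 < d)%N by apply: leq_trans td; apply: leq_trans t2c; rewrite cE; clear; lia.
have dn : (d <= n)%N by exact: leq_div.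
have ld : n = (l + d)%N by rewrite subnK.
have ln : (l < n)%N by rewrite ld -[X in (X < _)%N]addn0 ltn_add2l.
have nld : (n - l = d)%N by rewrite ld addKn.
have pE : (n %/ (b * (e0 * 2)) = (d %/ e0) %/ 2)%N by rewrite -!divnMA mulnA.
have half : ((d %/ e0) %/ 2 + c <= d %/ e0)%N.
  by move: t2c (leq_divM (d %/ e0) 2); clear; lia.
have := sampling S lowb AW (leq_ltn_trans (leq0n _) mW) b1 b2 m12 exch ln.
rewrite rWk nld => H1.
have H2 := bad_sum (A := A) (a' := a') W1 ld n0 kn.
rewrite rWk in H2; have {}H2 := H2 _ few.
have H3 : (q ^ (r * n) <= q ^ (k * k) * #|[set X | inside S X && (W *m X == 0%R)]| *
    q ^ (d %/ e0 %/ 2))%N.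
  by apply: leq_trans Nr _; rewrite pE leq_mul2r NW orbT.
exfalso; apply: (counting_contradiction q1 n0 _ _ _ _ H1 H2 H3).
- by move: rmk; clear; lia.
- by rewrite -cE addnC.
- move: half td t2c bd5 ld; rewrite -cE; move: (d %/ e0)%N => t; rewrite mulnDl.
  by move: (t %/ 2)%N => x; clear; lia.
- apply: (@leq_trans ((k + 5) * d)%N).
    move: half td t2c; rewrite -cE mulnDl; move: (d %/ e0)%N => t.
    by move: (t %/ 2)%N => x; clear; lia.
  by rewrite leq_divRL // mulnC mulnA -/b.
Qed.

(** The relations with coefficient sum 0 form [kermx (affine X)]. It contains the row space of [A],
    and at affine rank [k - m] both have dimension [m]. *)
Lemma generic_of_rank n (S : {set 'rV[F]_n}) : (m <= k)%N ->
  (0 < #|solutions A S (k - m)|)%N -> contains_generic_solution A S.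
Proof.
move=> mk; rewrite card_gt0 => /set0Pn[X]; rewrite inE => /and3P[/forallP XS /eqP AX /eqP rX].
exists (fun j => row j X); split=> // [i|mu].
  transitivity (row i (A *m X)); last by rewrite AX row0.
  by rewrite row_mul mulmx_sum_row; apply: eq_bigr => j _; rewrite mxE.
have AK : (A <= kermx (affine X))%MS.
  by apply/sub_kermxP; rewrite /affine mul_mx_row AX A_ones row_mx0.
have KA : (kermx (affine X) <= A)%MS.
  by rewrite -(mxrank_leqif_sup AK) rankA mxrank_ker rX subKn.
have -> : (mu <= A)%MS = (mu <= kermx (affine X))%MS.
  by apply/idP/idP => H; apply: submx_trans H _.
rewrite -mulmx_sum_row.
have -> : (\sum_j mu 0 j = 0) <-> (mu *m ones = 0).
  split=> [H|/matrixP/(_ 0 0)].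
    apply/matrixP => i j; rewrite !mxE -[RHS]H; apply: eq_bigr => c _.
    by rewrite mxE mulr1 ord1.
  by rewrite !mxE => H; rewrite -[RHS]H; apply: eq_bigr => c _; rewrite mxE mulr1.
split=> [[muX mu1]|/sub_kermxP].
  by apply/sub_kermxP; rewrite /affine mul_mx_row muX mu1 row_mx0.
by rewrite /affine mul_mx_row -[0 in X in X -> _]row_mx0 => /eq_row_mx.
Qed.

(** Induction on the gap [t] to the rank [k - m]. Quantifying over all [r' >= r] accommodates
    increments by more than one. *)
Lemma generic_of_many_solutions t r : (k = r + t + m)%N ->
  exists a n0, (0 < a)%N /\ forall n (S : {set 'rV[F]_n}) r', (n0 <= n)%N -> (r <= r')%N ->
    (q ^ (r' * n) <= #|solutions A S r'| * q ^ (n %/ a))%N -> (0 < #|solutions A S (k - m)|)%N.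
Proof.
have q1 : (1 < q)%N by exact: card_finNzRing_gt1.
elim: t r => [|t IH] r kE.
  exists 1%N, 0%N; split=> // n S r' _ rr' H.
  have Npos : (0 < #|solutions A S r'|)%N.
    by rewrite lt0n; apply: contraTneq H => ->; rewrite mul0n -ltnNge expn_gt0 (ltnW q1).
  (* No solution has larger affine rank, because its kernel contains the row space of [A]. *)
  suff <- : r' = (k - m)%N by [].
  have [W [AW W1 rW _]] := popular_kernel Npos.
  have : (r' <= k)%N.
    move: Npos; rewrite card_gt0 => /set0Pn[X]; rewrite inE => /and3P[_ _ /eqP <-].
    exact: rank_leq_row.
  by have := mxrankS AW; rewrite rankA rW; move: rr' kE; clear; lia.
have [a' [n0' [a'0 H']]] := IH r.+1 ltac:(rewrite kE; clear; lia).
have [a [n0 [aa' a0 H]]] := increment (r := r) ltac:(rewrite kE; clear; lia) a'0.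
exists a, (maxn n0 n0'); split=> // n S r'; rewrite geq_max => /andP[n0n n0'n].
rewrite leq_eqVlt => /orP[/eqP <-|rr'] Nr.
  by have [r'' rr''] := H n S n0n Nr; exact: H'.
apply: (H' n S r' n0'n rr'); apply: leq_trans Nr _.
by rewrite leq_mul2l leq_exp2l // leq_div2l // orbT.
Qed.

End Conclusion.

(** * Constant solutions and the final estimate *)

Section Diagonal.
Import boot.fintype boot.finset.
Local Open Scope ring_scope.
Variables (F : finFieldType) (m k : nat) (A : 'M[F]_(m, k)).
Local Notation ones := (const_mx 1 : 'cV[F]_k).

(** Each [s] in [S] gives the constant solution with all rows [s], whose affine span is a point. *)
Lemma card_le_solutions1 n (S : {set 'rV[F]_n}) : (0 < k)%N -> A *m ones = 0 ->
  (#|S| <= #|solutions A S 1|)%N.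
Proof.
case: k A => // k' A' _ A1; pose f (s : 'rV[F]_n) : 'M[F]_(k'.+1, n) := const_mx 1 *m s.
have row_f s j : row j (f s) = s.
  by apply/rowP => c; rewrite !mxE big_ord1 mxE mul1r.
have finj : injective f by move=> s s' ff; rewrite -(row_f s 0) ff row_f.
rewrite -(card_imset _ finj); apply/subset_leq_card/subsetP => _ /imsetP[s sS ->].
rewrite inE; apply/and3P; split.
- by apply/forallP => j; rewrite row_f.
- by rewrite mulmxA A1 mul0mx.
have -> : affine (f s) = (const_mx 1 : 'cV_k'.+1) *m row_mx s (1%:M : 'M_1).
  by rewrite mul_mx_row mulmx1.
rewrite eqn_leq; apply/andP; split.
  exact: leq_trans (mxrankM_maxl _ _) (rank_leq_col _).
rewrite lt0n mxrank_eq0; apply/eqP => /matrixP/(_ 0 (rshift n 0)).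
by rewrite !mxE big_ord1 mxE row_mxEr !mxE mulr1 => /eqP; rewrite oner_eq0.
Qed.

Lemma contains_generic_solution0 n (S : {set 'rV[F]_n}) : k = 0%N -> contains_generic_solution A S.
Proof.
move=> k0; have noj (j : 'I_k) : False by have := leq_ltn_trans (leq0n j) (ltn_ord j); rewrite [X in (_ < X)%N]k0.
exists (fun=> 0); split=> [i|mu|j]; [by rewrite big1 // => j | | by case: (noj j)].
have mu0 : mu = 0 by apply/rowP => j; case: (noj j).
by split=> _; [rewrite mu0 sub0mx | split; apply: big1 => j; case: (noj j)].
Qed.

End Diagonal.

Local Open Scope ring_scope.

Theorem theoremA (R : realType) (F : finFieldType) (m k : nat)
    (A : 'M[F]_(m, k)) :
  row_balanced A -> \rank A = m -> tame A -> temperate R A.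
Proof.
move=> balA rankA tameA.
have [k0|kpos] := posnP k.
  exists 1 => //; exists 0; exists 0%N => // n _ S []; exact: contains_generic_solution0.
have A1 : A *m (const_mx 1 : 'cV_k) = 0.
  apply/matrixP => i j; rewrite !mxE -[RHS](balA i).
  by apply: eq_bigr => c _; rewrite mxE mulr1.
(* The nonzero all-ones column lies in the kernel of [A]. *)
have mk : (m < k)%N.
  have := mxrank_mul_min A (const_mx 1%R : 'cV[F]_k); rewrite A1 mxrank0 rankA.
  have : (0 < \rank (const_mx 1%R : 'cV[F]_k))%N.
    rewrite lt0n mxrank_eq0; apply/eqP => /matrixP/(_ (Ordinal kpos) 0).
    by rewrite !mxE => /eqP; rewrite oner_eq0.
  by move: (\rank _); clear; lia.
have kE : k = (1 + (k - 1 - m) + m)%N by move: mk; clear; lia.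
have [a [n0 [a0 H]]] := generic_of_many_solutions R A1 rankA tameA kE.
have q1 : (1 < #|F|)%N by exact: card_finNzRing_gt1.
have q1R : 1 <= #|F|%:R :> R by rewrite ler1n ltnW.
exists (a%:R^-1); first by rewrite invr_gt0 ltr0n.
(* The constant [q] absorbs the rounding in [n %/ a]. *)
exists #|F|%:R; exists n0 => // n /= n0n S noS.
have small : (#|S| * #|F| ^ (n %/ a) < #|F| ^ n)%N.
  rewrite ltnNge; apply/negP => big; apply: noS; apply: (generic_of_rank A1 rankA (ltnW mk)).
  apply: (H n S 1%N n0n (leqnn _)); rewrite mul1n; apply: leq_trans big _.
  by rewrite leq_mul2r card_le_solutions1 ?orbT.
have {}small : (#|S| <= #|F| ^ (n - n %/ a))%N.
  have aN : (n %/ a <= n)%N by exact: leq_div.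
  by move: small; rewrite -[X in (_ < _ ^ X)%N](subnK aN) expnD ltn_mul2r => /andP[_ /ltnW].
apply: (@le_trans _ _ (#|F| ^ (n - n %/ a))%:R); first by rewrite ler_nat.
rewrite natrX -powR_mulrn ?ler0n // -{2}[#|F|%:R]powRr1 ?ler0n // -powRD; last first.
  by apply/implyP => _; rewrite pnatr_eq0 -lt0n ltnW.
apply: ler_powR => //; rewrite natrB ?leq_div // mulrBl mul1r.
suff: a%:R^-1 * n%:R <= (n %/ a)%:R + 1 :> R by lra.
rewrite mulrC ler_pdivrMr ?ltr0n // natr1 -natrM ler_nat.
by rewrite ltnW // ltn_ceil.
Qed.
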